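(* Fix an integer $d\ge 2$. For $h\ge1$ let $n=\frac{d^{h+1}-1}{d-1}$, let $P$ be the transition matrix of the interchange process on the complete $d$-ary tree $\mathcal T_h$ of height $h$, and let $d(t)$ be its total variation distance to uniformity after $t$ steps started from the identity. (a) The spectral gap of $P$ is $$\frac{(d-1)^2}{2(n-1)d^{h+1}}+O\left(\frac{\log_d n}{n^3}\right)\qquad\text{as } h\to\infty.$$ (b) For any constant $\varepsilon>0$, if $t=\frac{1}{d-1}n^2\log n-\frac1{d-1}n^2\log\left(\frac1\varepsilon\right)+O(n^2)$, then $d(t)\ge 1-\varepsilon$. Precisely: there is a constant $C>0$ depending only on $d$ such that for every $\varepsilon>0$, for all sufficiently large $h$ (depending on $d$ and $\varepsilon$) and every integer $t$ with $$0\le t\le \frac{1}{d-1}n^2\log n-\frac{1}{d-1}n^2\log\left(\frac1\varepsilon\right)-Cn^2,$$ one has $d(t)\ge 1-\varepsilon$.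
   Context: $\mathcal T_h$ is the complete rooted $d$-ary tree of height $h$: every vertex at distance less than $h$ from the root has exactly $d$ children, and the vertices at distance $h$ from the root are leaves. It has $n=1+d+\dots+d^h=\frac{d^{h+1}-1}{d-1}$ vertices and $n-1$ edges. Interchange process on $\mathcal T_h$: enumerate the vertices by $1,\dots,n$ and place card $i$ at vertex $i$ at time zero. At each step, choose an edge uniformly at random among the $n-1$ edges and flip a fair coin; if heads, interchange the cards at the two ends of the edge; if tails, do nothing. Configurations are elements of the symmetric group $S_n$, and $P$ is the resulting transition matrix on $S_n$. $P^t_{id}(g)$ is the probability of being at $g\in S_n$ after $t$ steps starting from the identity, and $$d(t)=\frac12\sum_{g\in S_n}\left|P^t_{id}(g)-\frac1{n!}\right|.$$ The spectral gap of an irreducible reversible transition matrix is $1-\max\{|\mu|:\mu\ne 1\text{ an eigenvalue}\}$ (for $P$ all eigenvalues are nonnegative, so this is $1$ minus the second largest eigenvalue). $\log$ is the natural logarithm and $\log_d$ the logarithm in base $d$. The constant implied in the $O$ of part (a) may depend on $d$. *)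

(* Defs.v *)
From HB Require Import structures.
From mathcomp Require Import all_boot all_order all_fingroup all_algebra.
From mathcomp Require Import all_classical all_reals all_analysis.
Set Implicit Arguments.
Unset Strict Implicit.
Unset Printing Implicit Defensive.
Import Order.TTheory GRing.Theory Num.Theory.
Import numFieldNormedType.Exports.
Local Open Scope classical_set_scope.
Local Open Scope ring_scope.

(* A vertex of the complete d-ary tree of height h is the word recording the
   child chosen at each step of the path from the root (the empty word). *)
Definition tree_vertex (d h : nat) : finType := {bseq h of 'I_d}.

(* Each edge occurs once, as the pair (parent, child). *)
Definition tree_edges (d h : nat) : {set tree_vertex d h * tree_vertex d h} :=
  [set e : tree_vertex d h * tree_vertex d h |
    [exists i : 'I_d, bseqval e.2 == rcons (bseqval e.1) i]]%SET.

Definition tree_size (d h : nat) : nat := (d ^ h.+1 - 1) %/ (d - 1).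

(* A configuration g assigns to each vertex v the card g v lying on it, cards
   being named after their initial vertices. Since (s * t)%g x = t (s x),
   interchanging the cards at u and v turns g into (tperm u v * g)%g. *)
Definition interchange_prob (R : realType) (V : finType) (E : {set V * V})
    (g g' : {perm V}) : R :=
  \sum_(e in E) #|E|%:R^-1 *
    (2^-1 * (g' == (tperm e.1 e.2 * g)%g)%:R + 2^-1 * (g' == g)%:R).

Definition interchange_mx (R : realType) (V : finType) (E : {set V * V}) :
    'M[R]_#|{perm V}| :=
  \matrix_(i, j) interchange_prob R E (enum_val i) (enum_val j).

Definition interchange_law (R : realType) (V : finType) (E : {set V * V})
    (t : nat) (g : {perm V}) : R :=
  (interchange_mx R E ^+ t) (enum_rank (1%g : {perm V})) (enum_rank g).

Definition interchange_tv (R : realType) (V : finType) (E : {set V * V})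
    (t : nat) : R :=
  2^-1 * \sum_(g : {perm V}) `|interchange_law R E t g - ((#|V|)`!)%:R^-1|.

(* For reversible P all eigenvalues are real, and the supremum is over a
   finite set, hence a maximum. *)
Definition spectral_gap (R : realType) (m : nat) (P : 'M[R]_m) : R :=
  1 - sup [set `|mu| | mu in [set mu : R | eigenvalue P mu /\ mu != 1]].

Lemma tree_size_sum (d h : nat) : (1 < d)%N ->
  tree_size d h = (\sum_(k < h.+1) d ^ k)%N.
Proof.
move=> d1; rewrite /tree_size !subn1 predn_exp mulKn //.
by rewrite -subn1 subn_gt0.
Qed.

Lemma card_tree_vertex (d h : nat) : (1 < d)%N ->
  #|tree_vertex d h| = tree_size d h.
Proof.
move=> d1; rewrite card_bseq tree_size_sum //.
by apply: eq_bigr => i _; rewrite card_ord.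
Qed.

Lemma card_tree_edges (d h : nat) : (1 < d)%N ->
  #|tree_edges d h| = (tree_size d h - 1)%N.
Proof.
move=> d1; rewrite -card_tree_vertex //.
have inj : {in tree_edges d h &, injective snd}.
  move=> [u v] [u' v']; rewrite !inE /= => /existsP[i /eqP vi].
  move=> /existsP[j /eqP vj] vv'; rewrite -vv' vi in vj *.
  by case/rcons_inj: vj => uu' _; congr pair => //; apply: val_inj.
rewrite -(card_in_imset inj) subn1 -(cardsC1 ([bseq] : tree_vertex d h)).
apply: eq_card => v; rewrite !inE; apply/imsetP/idP.
  case=> -[u w]; rewrite inE /= => /existsP[i /eqP wi] ->.
  by apply/eqP => w0; move: wi; rewrite w0 /=; case: (bseqval u).
case: v => s; case/lastP: s => [|s i] sh; first by case/eqP; apply: val_inj.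
have sh' : (size s <= h)%N by rewrite (leq_trans _ sh) // size_rcons.
move=> _; exists (Bseq sh' : tree_vertex d h, Bseq sh : tree_vertex d h) => //.
by rewrite inE; apply/existsP; exists i; rewrite /=.
Qed.

(* Main.v *)
Require Import Defs.
From HB Require Import structures.
From mathcomp Require Import all_boot all_order all_fingroup all_algebra.
From mathcomp Require Import all_classical all_reals all_analysis.
From mathcomp Require Import ring lra.
Set Implicit Arguments.
Unset Strict Implicit.
Unset Printing Implicit Defensive.
Import Order.TTheory GRing.Theory Num.Theory.
Import numFieldNormedType.Exports.
Local Open Scope classical_set_scope.
Local Open Scope ring_scope.

(* The spectral gap is computed exactly. By the argument of Handjani and Jungreis
   (Aldous' conjecture for trees), removing leaves one by one shows that a
   Poincare inequality for functions of a single vertex lifts, with the same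
   constant, to functions of a permutation; so the gap is l / (2 (n - 1)), with l
   the spectral gap of the Laplacian of the tree. The number l is the first
   eigenvalue of a branch with Dirichlet condition at the root: the positive
   radial eigenfunction g gives the lower bound through Barta's argument, and the
   function equal to g and - g on two branches and to 0 elsewhere is an
   eigenfunction of the whole tree. Summing the radial equation twice, with g = 1
   at the leaves, gives l = (d - 1)^2 / d^(h + 1) + O(h / d^(2 h)).

   Part (b) is Wilson's method: with phi the antisymmetric eigenfunction above,
   Phi s = sum_x phi x * phi (s x) is an eigenfunction on permutations, whose
   one-step fluctuations are bounded by the Dirichlet energy of phi, so that its
   variance is at most twice the squared norm of phi at all times. *)

(** * Functions of permutations supported on a set *)

Section PermOn.
Variables (R : realFieldType) (V : finType).
Implicit Types (A : {set V}) (f : {perm V} -> R) (M : V -> V -> R).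

Lemma perm_on_tperm A (x y : V) : x \in A -> y \in A -> perm_on A (tperm x y).
Proof.
move=> xA yA; apply/fintype.subsetP => z.
by rewrite inE; case: tpermP => [->|->|]; rewrite ?eqxx.
Qed.

Lemma perm_onM_tperm A (x y : V) (g : {perm V}) : x \in A -> y \in A ->
  perm_on A (g * tperm x y)%g = perm_on A g.
Proof.
move=> xA yA; have tA := perm_on_tperm xA yA.
apply/idP/idP => h; last exact: perm_onM.
by rewrite -(mulgK (tperm x y) g) tpermV; apply: perm_onM.
Qed.

Lemma perm_on_tpermM A (x y : V) (g : {perm V}) : x \in A -> y \in A ->
  perm_on A (tperm x y * g)%g = perm_on A g.
Proof.
move=> xA yA; have tA := perm_on_tperm xA yA.
apply/idP/idP => h; last exact: perm_onM.
by rewrite -(mulKg (tperm x y) g) tpermV; apply: perm_onM.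
Qed.

Lemma perm_onD1 A x (g : {perm V}) : perm_on (A :\ x) g = perm_on A g && (g x == x).
Proof.
apply/idP/andP => [gA|[gA /eqP gx]].
  split; last by rewrite (out_perm gA) // !inE eqxx.
  by apply/fintype.subsetP => z /(fintype.subsetP gA); rewrite inE => /andP[].
apply/fintype.subsetP => z zg; rewrite !inE (fintype.subsetP gA) // andbT.
by apply: contraTneq zg => ->; rewrite inE gx eqxx.
Qed.

Lemma sum_perm_on_const A (c : R) :
  \sum_(g : {perm V} | perm_on A g) c = (#|A|)`!%:R * c.
Proof. by rewrite sumr_const mulr_natl -(card_perm A). Qed.

(** Right multiplication by [tperm x i] maps the permutations of [A] fixing [x] bijectively onto
    those sending [x] to [i]. *)
Lemma sum_perm_on_fiber A x i f : x \in A -> i \in A ->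
  \sum_(g | perm_on A g && (g x == i)) f g =
  \sum_(g | perm_on (A :\ x) g) f (g * tperm x i)%g.
Proof.
move=> xA iA; rewrite (reindex_inj (mulIg (tperm x i))) /=.
apply: eq_bigl => g; rewrite perm_onM_tperm // perm_onD1 permM; congr andb.
by rewrite -[X in _ == X](tpermL x i) (inj_eq perm_inj).
Qed.

Lemma sum_perm_on_split A x f : x \in A ->
  \sum_(g | perm_on A g) f g =
  \sum_(i in A) \sum_(g | perm_on (A :\ x) g) f (g * tperm x i)%g.
Proof.
move=> xA; rewrite (partition_big (fun g : {perm V} => g x) (mem A)) /=.
  by apply: eq_bigr => i iA; rewrite sum_perm_on_fiber.
by move=> g gA; rewrite (perm_closed _ gA).
Qed.

Lemma sum_perm_on_eval A x (phi : V -> R) : x \in A ->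
  \sum_(g : {perm V} | perm_on A g) phi (g x) = (#|A|.-1)`!%:R * \sum_(i in A) phi i.
Proof.
move=> xA; rewrite (sum_perm_on_split _ xA) mulr_sumr; apply: eq_bigr => i iA.
rewrite (eq_bigr (fun=> phi i)) => [|g]; last first.
  by rewrite perm_onD1 permM => /andP[_ /eqP->]; rewrite tpermL.
by rewrite sum_perm_on_const [in RHS](cardsD1 x) xA.
Qed.

Definition mxfun A M (g : {perm V}) : R := \sum_(x in A) M x (g x).

Definition marginal A f (x i : V) : R := \sum_(g | perm_on A g && (g x == i)) f g.

Definition doubly_centered A M :=
  (forall x, x \in A -> \sum_(i in A) M x i = 0) /\
  (forall i, i \in A -> \sum_(x in A) M x i = 0).

(** So [marginal A] is the adjoint of [mxfun A], and a function with zero marginals is orthogonal to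
    every [mxfun A M]. *)
Lemma sum_mul_mxfun A M f :
  \sum_(g | perm_on A g) f g * mxfun A M g =
  \sum_(x in A) \sum_(i in A) M x i * marginal A f x i.
Proof.
under eq_bigr => g _ do rewrite /mxfun mulr_sumr.
rewrite exchange_big /=; apply: eq_bigr => x xA.
rewrite (partition_big (fun g : {perm V} => g x) (mem A)) /=; last first.
  by move=> g gA; rewrite (perm_closed _ gA).
apply: eq_bigr => i iA; rewrite /marginal mulr_sumr.
by apply: eq_bigr => g /andP[_ /eqP->]; rewrite mulrC.
Qed.

(** The scalar by which [mxfun A] followed by [marginal A] acts on doubly centered matrices; it is
    [m * (m - 2)!] when [m = |A| >= 2]. *)
Definition centered_scale A : R := (#|A|.-1)`!%:R + (#|A|.-2)`!%:R.

Lemma centered_scale_gt0 A : 0 < centered_scale A.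
Proof. by rewrite addr_gt0 // ltr0n fact_gt0. Qed.

(** On the fiber [g x = i], row [x] contributes [(m - 1)!] times [M x i]. For [y != x], [g y] takes
    each value other than [i] exactly [(m - 2)!] times, so zero row sums leave [- M y i]; the zero
    column sum then adds these up to [M x i]. *)
Lemma marginal_mxfun A M x i : doubly_centered A M -> x \in A -> i \in A ->
  marginal A (mxfun A M) x i = centered_scale A * M x i.
Proof.
move=> [rowM colM] xA iA; rewrite /marginal sum_perm_on_fiber // exchange_big /=.
rewrite (big_setD1 x) //= mulrDl; congr (_ + _).
  rewrite (eq_bigr (fun=> M x i)) => [|g]; last first.
    by rewrite perm_onD1 permM => /andP[_ /eqP->]; rewrite tpermL.
  by rewrite sum_perm_on_const [in RHS](cardsD1 x) xA.
rewrite (eq_bigr (fun y => - ((#|A|.-2)`!%:R * M y i))) => [|y yAx].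
  rewrite sumrN -mulr_sumr -mulrN; congr (_ * _).
  by have /eqP := colM i iA; rewrite (big_setD1 x) //= addr_eq0 => /eqP->.
under eq_bigr do rewrite permM.
rewrite (sum_perm_on_eval (fun j => M y (tperm x i j))) //.
have -> : #|A :\ x|.-1 = #|A|.-2 by rewrite [in RHS](cardsD1 x) xA.
rewrite -mulrN; congr (_ * _).
have yA : y \in A by move: yAx; rewrite inE => /andP[].
have /eqP := rowM _ yA; rewrite (reindex_inj (@perm_inj _ (tperm x i))) /=.
rewrite (eq_bigl (mem A)) => [|j]; last first.
  by case: tpermP => [->|->|] //; rewrite ?xA ?iA.
by rewrite (big_setD1 x) //= tpermL addr_eq0 => /eqP->; rewrite opprK.
Qed.

Lemma sum_mxfun_sqr A M : doubly_centered A M ->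
  \sum_(g | perm_on A g) mxfun A M g ^+ 2 =
  centered_scale A * \sum_(x in A) \sum_(i in A) M x i ^+ 2.
Proof.
move=> cM; under eq_bigr do rewrite expr2.
rewrite sum_mul_mxfun mulr_sumr; apply: eq_bigr => x xA.
rewrite mulr_sumr; apply: eq_bigr => i iA; rewrite marginal_mxfun //; ring.
Qed.

Lemma sum_tperm A (u v : V) (F : V -> R) : u \in A -> v \in A ->
  \sum_(x in A) F (tperm u v x) = \sum_(x in A) F x.
Proof.
move=> uA vA; rewrite [RHS](reindex_inj (@perm_inj _ (tperm u v))) /=.
by apply: eq_bigl => x; case: tpermP => [->|->|] //; rewrite ?uA ?vA.
Qed.

Lemma mxfun_tperm A M u v g : u \in A -> v \in A ->
  mxfun A M (tperm u v * g)%g = mxfun A (fun x => M (tperm u v x)) g.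
Proof.
move=> uA vA; rewrite /mxfun -(sum_tperm _ uA vA).
by apply: eq_bigr => x _; rewrite permM tpermK.
Qed.

(** The swap permutes the rows of [M], so the difference is again an [mxfun], of a matrix [M']
    supported on rows [u] and [v], which are opposite to each other. *)
Lemma sum_mxfun_diff_sqr A M u v : u \in A -> v \in A -> u != v ->
  doubly_centered A M ->
  \sum_(g | perm_on A g) (mxfun A M (tperm u v * g)%g - mxfun A M g) ^+ 2 =
  centered_scale A * (2 * \sum_(i in A) (M u i - M v i) ^+ 2).
Proof.
move=> uA vA uv [rowM colM].
pose M' x i := M (tperm u v x) i - M x i.
have cM' : doubly_centered A M'.
  split=> [x xA|i iA]; rewrite sumrB.
    by rewrite !rowM ?subr0 //; case: tpermP.
  by rewrite (sum_tperm (fun x => M x i)) // subrr.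
rewrite (eq_bigr (fun g => mxfun A M' g ^+ 2)) => [|g _]; last first.
  by rewrite mxfun_tperm // /mxfun -sumrB.
rewrite sum_mxfun_sqr //; congr (_ * _).
rewrite (big_setD1 u) //= [X in _ + X](big_setD1 v) ?inE ?vA 1?eq_sym ?uv //=.
rewrite [X in _ + (_ + X)]big1 ?addr0 => [|x].
  rewrite /M' tpermL tpermR mulrDl !mul1r; congr (_ + _).
  by apply: eq_bigr => i _; rewrite -sqrrN opprB.
rewrite !inE => /and3P[xv xu _]; rewrite big1 // => i _.
by rewrite /M' tpermD 1?eq_sym // subrr expr0n.
Qed.

Lemma marginal_centered A f : \sum_(g | perm_on A g) f g = 0 ->
  doubly_centered A (marginal A f).
Proof.
move=> f0; split=> [x xA|i iA].
  rewrite -[RHS]f0 [RHS](partition_big (fun g : {perm V} => g x) (mem A)) //=.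
  by move=> g gA; rewrite (perm_closed _ gA).
rewrite -[RHS]f0 [RHS](partition_big (fun g : {perm V} => (g^-1)%g i) (mem A)) /=.
  apply: eq_bigr => x xA; apply: eq_bigl => g; congr andb.
  by rewrite -[in RHS](inj_eq (@perm_inj _ g)) permKV eq_sym.
by move=> g gA; rewrite (perm_closed _ (perm_onV gA)).
Qed.
End PermOn.

(** * The Poincare inequality on permutations of a tree *)

Section RootedTree.
Variables (R : realFieldType) (V : finType) (r : V) (p : V -> V) (rk : V -> nat).
Hypothesis rk_p : forall v, v != r -> (rk (p v) < rk v)%N.

Definition subtree (A : {set V}) :=
  r \in A /\ (forall v, v \in A :\ r -> p v \in A).

Definition vertex_poincare (A : {set V}) (lam : R) := forall phi : V -> R,
  \sum_(v in A) phi v = 0 ->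
  lam * \sum_(v in A) phi v ^+ 2 <= \sum_(v in A :\ r) (phi (p v) - phi v) ^+ 2.

(** The factor 2 matches the constants: a swap along an edge changes a function of one card's
    position at both ends, while [vertex_poincare] counts each edge once. *)
Definition perm_poincare (A : {set V}) (lam : R) := forall f : {perm V} -> R,
  \sum_(g | perm_on A g) f g = 0 ->
  lam * (2 * \sum_(g | perm_on A g) f g ^+ 2) <=
  \sum_(v in A :\ r) \sum_(g | perm_on A g) (f (tperm (p v) v * g)%g - f g) ^+ 2.

(** A vertex of maximal rank is the parent of no vertex. *)
Lemma subtree_leaf A : subtree A -> A :\ r != finset.set0 ->
  exists2 x, x \in A :\ r & subtree (A :\ x) /\ forall v, v \in A :\ r -> p v != x.
Proof.
move=> [rA pA] /finset.set0Pn[x0 x0A].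
case: (arg_maxnP rk x0A) => x xA xmax.
have npx v : v \in A :\ r -> p v != x.
  move=> vA; apply/eqP => pvx; have := rk_p (v := v).
  move: (vA); rewrite !inE => /andP[-> _] /(_ isT).
  by rewrite pvx ltnNge => /negP; apply; apply: xmax.
have /finset.setD1P[xr _] := xA.
exists x => //; split=> //; split=> [|v]; first by rewrite !inE eq_sym xr.
rewrite !inE => /and3P[vr vx vA]; have vAr : v \in A :\ r by rewrite !inE vr.
by rewrite npx //= pA.
Qed.

(** Extend [phi] to the leaf by its value at the parent, so that the edge at [x] carries no energy.
    Subtracting the mean [m] keeps the energy and, [phi] being centered on [A :\ x], can only
    increase the sum of squares. *)
Lemma vertex_poincare_leaf A x lam : 0 <= lam -> subtree A ->
  x \in A :\ r -> (forall v, v \in A :\ r -> p v != x) ->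
  vertex_poincare A lam -> vertex_poincare (A :\ x) lam.
Proof.
move=> lam0 [rA pA] xAr npx PA phi phi0.
move: (xAr); rewrite !inE => /andP[xr xA].
pose phi1 v := if v == x then phi (p x) else phi v.
pose m := (\sum_(v in A) phi1 v) / #|A|%:R.
have A0 : #|A|%:R != 0 :> R by rewrite pnatr_eq0 -lt0n; apply/card_gt0P; exists r.
have := PA (fun v => phi1 v - m).
rewrite sumrB sumr_const -[m *+ _]mulr_natr divfK // subrr => /(_ erefl).
rewrite [X in _ <= X](big_setD1 x) //= /phi1 (negPf (npx _ xAr)) eqxx.
rewrite subrr expr0n add0r => le1.
have -> : \sum_(v in A :\ x :\ r) (phi (p v) - phi v) ^+ 2 =
    \sum_(v in A :\ r :\ x) ((if p v == x then phi (p x) else phi (p v)) - m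
      - ((if v == x then phi (p x) else phi v) - m)) ^+ 2.
  rewrite (eq_bigl (mem (A :\ r :\ x))) => [|v]; last by rewrite !inE andbCA.
  apply: eq_bigr => v; rewrite !inE => /and3P[vx vr vA].
  by rewrite (negPf vx) (negPf (npx _ _)) ?inE ?vr //; congr (_ ^+ 2); ring.
apply: le_trans le1; rewrite ler_wpM2l // [X in _ <= X](big_setD1 x) //= eqxx.
rewrite [X in _ <= _ + X](eq_bigr (fun v => phi v ^+ 2 +
   ((- (m *+ 2)) * phi v + m ^+ 2))); last first.
  by move=> v; rewrite !inE => /andP[/negPf-> _]; ring.
rewrite !big_split /= -mulr_sumr phi0 mulr0 add0r addrCA lerDl.
by rewrite addr_ge0 ?sqr_ge0 // sumr_ge0 // => v _; rewrite sqr_ge0.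
Qed.

(* Split f = w + u with w the orthogonal projection of f onto the functions
   mxfun A M. These form an invariant space on which the exchange dynamics is a
   family of independent vertex chains, so w is controlled by the vertex
   inequality. As u has vanishing marginals, it is centered on each fiber
   [g x = i], where dropping the edge at the leaf x leaves the dynamics on
   A :\ x. *)
Lemma perm_poincare_leaf A x lam : subtree A -> x \in A :\ r ->
  vertex_poincare A lam -> perm_poincare (A :\ x) lam -> perm_poincare A lam.
Proof.
move=> [rA pA] xAr VA PA f f0.
move: (xAr); rewrite !inE => /andP[xr xA].
pose M := marginal A f; have cM : doubly_centered A M := marginal_centered f0.
pose k := centered_scale R A; have k0 : 0 < k := centered_scale_gt0 R A.
pose w g := k^-1 * mxfun A M g; pose u g := f g - w g.
have mu y i : y \in A -> i \in A -> marginal A u y i = 0.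
  move=> yA iA; rewrite /marginal sumrB -mulr_sumr.
  rewrite -/(marginal A (mxfun A M) y i) marginal_mxfun // -/k mulKf ?gt_eqF //.
  by rewrite subrr.
have uw M' : \sum_(g | perm_on A g) u g * mxfun A M' g = 0.
  rewrite sum_mul_mxfun big1 // => y yA; rewrite big1 // => i iA.
  by rewrite mu // mulr0.
have pv v : v \in A :\ r -> [/\ v \in A, p v \in A & p v != v].
  move=> vA; have := pA v vA; move: vA; rewrite !inE => /andP[vr vA] pvA.
  by split=> //; apply: contraTneq (rk_p vr) => ->; rewrite ltnn.
have sumf : \sum_(g | perm_on A g) f g ^+ 2 =
    \sum_(g | perm_on A g) w g ^+ 2 + \sum_(g | perm_on A g) u g ^+ 2.
  transitivity (\sum_(g | perm_on A g)
     ((w g ^+ 2 + u g ^+ 2) + 2 * k^-1 * (u g * mxfun A M g))).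
    by apply: eq_bigr => g _; rewrite /u /w; ring.
  by rewrite big_split /= -mulr_sumr uw mulr0 addr0 big_split.
(* No cross terms here either: the swap turns [mxfun A M] into another [mxfun], and [u] is
   orthogonal to all of them. *)
have sumd v : v \in A :\ r ->
    \sum_(g | perm_on A g) (f (tperm (p v) v * g)%g - f g) ^+ 2 =
    \sum_(g | perm_on A g) (w (tperm (p v) v * g)%g - w g) ^+ 2 +
    \sum_(g | perm_on A g) (u (tperm (p v) v * g)%g - u g) ^+ 2.
  case/pv=> vA pvA _; set t := tperm (p v) v.
  transitivity (\sum_(g | perm_on A g)
     (((w (t * g)%g - w g) ^+ 2 + (u (t * g)%g - u g) ^+ 2) +
      2 * k^-1 * (u (t * g)%g * (mxfun A M (t * g)%g - mxfun A M g)
         - (u g * mxfun A M (t * g)%g - u g * mxfun A M g)))).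
    by apply: eq_bigr => g _; rewrite /u /w; ring.
  rewrite big_split /= -mulr_sumr !sumrB uw.
  rewrite [X in _ - (X - _)](eq_bigr
    (fun g => u g * mxfun A (fun x => M (t x)) g)) => [|g _]; last first.
    by rewrite mxfun_tperm.
  rewrite uw subr0 subr0.
  have -> : \sum_(g | perm_on A g) u (t * g)%g * (mxfun A M (t * g)%g - mxfun A M g)
     = \sum_(g | perm_on A g) u g * (mxfun A M g - mxfun A (fun x => M (t x)) g).
    rewrite [RHS](reindex_inj (mulgI t)) /=; apply: eq_big => g.
      by rewrite perm_on_tpermM.
    rewrite -(mxfun_tperm M (t * g)%g) // mulgA tperm2 mul1g //.
  have -> : \sum_(g | perm_on A g) u g *
      (mxfun A M g - mxfun A (fun x => M (t x)) g) = 0.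
    by under eq_bigr do rewrite mulrBr; rewrite sumrB !uw subrr.
  by rewrite mulr0 addr0 big_split.
rewrite (eq_bigr _ sumd) big_split sumf /= !mulrDr lerD //.
  (* The [w] part: for each [i], the column of [M] at [i] is a centered function on [A], to which
     the vertex inequality applies. *)
  rewrite [X in _ <= X](eq_bigr (fun v =>
      \sum_(i in A) (2 * k^-1) * (M (p v) i - M v i) ^+ 2)) => [|v vAr]; last first.
    have [vA pvA vpv] := pv v vAr.
    under eq_bigr do rewrite /w -mulrBr exprMn.
    rewrite -!mulr_sumr (sum_mxfun_diff_sqr pvA vA vpv cM) -/k.
    by field; rewrite gt_eqF.
  rewrite exchange_big /=.
  under eq_bigr do rewrite /w exprMn.
  rewrite -mulr_sumr sum_mxfun_sqr // -/k exchange_big /=.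
  rewrite !mulr_sumr; apply: ler_sum => i iA; rewrite -mulr_sumr.
  rewrite [leLHS](_ : _ = 2 * k^-1 * (lam * \sum_(v in A) M v i ^+ 2)); last first.
    by field; rewrite gt_eqF.
  rewrite ler_wpM2l // ?mulr_ge0 ?invr_ge0 ?(ltW k0) //.
  by apply: VA; have [_] := cM; apply.
rewrite [X in _ <= X](big_setD1 x) //=.
apply: ler_wpDl; first by apply: sumr_ge0 => g _; rewrite sqr_ge0.
rewrite [X in _ <= X](eq_bigr (fun v => \sum_(i in A) \sum_(g | perm_on (A :\ x) g)
   (u (tperm (p v) v * (g * tperm x i))%g - u (g * tperm x i)%g) ^+ 2)); last first.
  by move=> v _; rewrite (sum_perm_on_split _ xA).
rewrite exchange_big /= (sum_perm_on_split _ xA) !mulr_sumr; apply: ler_sum => i iA.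
have := PA (fun g => u (g * tperm x i)%g).
rewrite -sum_perm_on_fiber // -/(marginal A u x i) mu // => /(_ erefl).
move=> /le_trans; apply; rewrite le_eqVlt; apply/orP; left; apply/eqP.
apply: eq_big => [v|v _]; first by rewrite !inE andbCA.
by apply: eq_bigr => g _; rewrite mulgA.
Qed.

Lemma perm_poincare_subtree A lam : 0 <= lam -> subtree A ->
  vertex_poincare A lam -> perm_poincare A lam.
Proof.
move=> lam0; have [n] := ubnP #|A|; elim: n A => // n IH A cA tA VA.
(* When [A] is reduced to [r], the identity is the only permutation, and a centered function
   vanishes there. *)
have [A0|A0] := eqVneq (A :\ r) finset.set0.
  have rA : r \in A by case: tA.
  have onlyr (v : V) : v \in A -> v = r.
    move=> vA; apply/eqP; apply: contraT => vr.
    by have := finset.in_set0 v; rewrite -A0 !inE vr vA.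
  have E1 (F : {perm V} -> R) : \sum_(g | perm_on A g) F g = F 1%g.
    rewrite (big_pred1 1%g) // => g; apply/idP/eqP => [gA|->]; last exact: perm_on1.
    apply/permP => v; rewrite perm1; have [vA|vA] := boolP (v \in A).
      have gvA : g v \in A by rewrite (perm_closed _ gA).
      by rewrite (onlyr _ gvA) (onlyr _ vA).
    by rewrite (out_perm gA).
  move=> f; rewrite !E1 => ->; rewrite expr0n !mulr0.
  by do 2!(apply: sumr_ge0 => ? _); rewrite sqr_ge0.
have [x xA [tAx npx]] := subtree_leaf tA A0.
apply: (perm_poincare_leaf tA xA VA); apply: IH => //.
  by have /finset.setD1P[_ xA'] := xA; move: cA; rewrite ltnS (cardsD1 x) xA'.
exact: (vertex_poincare_leaf lam0 tA xA npx VA).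
Qed.
End RootedTree.

(** * The radial eigenvalue equation *)

Section Radial.
Variables (R : rcfType) (d : nat).

(* Coordinates are counted from the leaves: at l, the first component is the
   value at distance m from the leaves of the radial solution of the eigenvalue
   equation with eigenvalue l and leaf value 1, and the second component is the
   decrement of this value towards the root. *)
Fixpoint radial (m : nat) : {poly R} * {poly R} :=
  if m is m'.+1 then
    let G := (radial m').1 - (radial m').2 in (G, d%:R *: (radial m').2 + 'X * G)
  else (1, 'X).

Local Notation G l m := ((radial m).1.[l]).
Local Notation S l m := ((radial m).2.[l]).

Lemma radialG0 l : G l 0 = 1. Proof. by rewrite /= hornerE. Qed.
Lemma radialS0 l : S l 0 = l. Proof. by rewrite /= hornerE. Qed.
Lemma radialGS l m : G l m.+1 = G l m - S l m.
Proof. by rewrite /= !hornerE. Qed.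
Lemma radialSS l m : S l m.+1 = d%:R * S l m + l * G l m.+1.
Proof. by rewrite /= !hornerE. Qed.

Lemma radialS_gt0 l m : (0 < d)%N -> 0 < l -> (forall j, (j <= m)%N -> 0 <= G l j) ->
  0 < S l m.
Proof.
move=> d0 l0; elim: m => [|m IH] G0; first by rewrite radialS0.
rewrite radialSS ltr_pwDl ?mulr_ge0 ?(ltW l0) ?G0 // mulr_gt0 ?ltr0n //.
by apply: IH => j jm; apply: G0; rewrite ltnW.
Qed.

(** Sturm comparison, cross-multiplied: the ratio [S / G] is nondecreasing in the eigenvalue. Since
    [G] stays positive exactly when [S / G < 1], positivity at [b] passes to every smaller [a]. *)
Lemma radial_mono a b m : 0 <= a -> a <= b -> (forall j, (j <= m)%N -> 0 < G b j) ->
  [/\ 0 < G a m, 0 <= S a m & S a m * G b m <= S b m * G a m].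
Proof.
move=> a0 ab; elim: m => [|m IH] Gb.
  by rewrite !radialG0 !radialS0 ltr01 !mulr1.
have [|Ga Sa SG] := IH; first by move=> j jm; apply: Gb; rewrite ltnW.
have := Gb m.+1 (leqnn _); have Gbm := Gb m (leqnSn _).
rewrite !radialSS !radialGS => Gb1.
have Ga1 : 0 < G a m - S a m.
  rewrite -(pmulr_lgt0 _ Gbm) mulrBl.
  have : 0 < G a m * (G b m - S b m) by rewrite mulr_gt0.
  by rewrite mulrBr; lra.
have d0 : 0 <= d%:R :> R by rewrite ler0n.
split=> //; first by rewrite addr_ge0 ?mulr_ge0 // ltW.
rewrite -subr_ge0 (_ : _ - _ = d%:R * (S b m * G a m - S a m * G b m) +
  (b - a) * ((G a m - S a m) * (G b m - S b m))); last by ring.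
by rewrite addr_ge0 // mulr_ge0 ?subr_ge0 // mulr_ge0 // ltW.
Qed.

Lemma radial_at0 j : G 0 j = 1 /\ S 0 j = 0.
Proof.
elim: j => [|j [IG IS]]; first by rewrite radialG0 radialS0.
by rewrite radialSS radialGS IG IS subr0 mulr0 mul0r addr0.
Qed.

(** By induction on the height: at the previous root [l] the next value of [G] is [- S l m.+1 < 0],
    whereas it is 1 at 0, so there is a root between 0 and [l]; comparison with [l] keeps the
    earlier values positive. *)
Lemma radial_root m : (0 < d)%N ->
  exists l : R, [/\ 0 < l, G l m.+1 = 0 & forall j, (j <= m)%N -> 0 < G l j].
Proof.
move=> d0; elim: m => [|m [l [l0 Gl Glj]]].
  exists 1; rewrite radialGS radialG0 radialS0 subrr; split=> // j.
  by rewrite leqn0 => /eqP->; rewrite radialG0.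
have Glge j : (j <= m.+1)%N -> 0 <= G l j.
  by rewrite leq_eqVlt => /orP[/eqP->|/Glj/ltW]; rewrite ?Gl.
have Sl := radialS_gt0 d0 l0 Glge.
have [mu muI] : exists2 mu, mu \in `[0, l] & root (- (radial m.+2).1) mu.
  apply: poly_ivt; first exact: ltW.
  rewrite !hornerN (radial_at0 m.+2).1 radialGS Gl sub0r opprK.
  by rewrite lerN10 ltW.
rewrite rootN => /rootP Gmu; move: muI; rewrite in_itv /= => /andP[mu0 mul].
have mune0 : 0 < mu.
  rewrite lt_neqAle mu0 andbT; apply/eqP => mu00; move: Gmu; rewrite -mu00.
  by rewrite (radial_at0 m.+2).1 => /eqP; rewrite oner_eq0.
have Gj j : (j <= m)%N -> 0 < G mu j.
  move=> jm; have [] := @radial_mono mu l j mu0 mul => // i ij.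
  by apply: Glj; rewrite (leq_trans ij).
have Gm1 : 0 <= G mu m.+1.
  have [] := @radial_mono mu l m mu0 mul => // _ _.
  move: Gl; rewrite !radialGS => /eqP; rewrite subr_eq0 => /eqP <-.
  by rewrite mulrC ler_pM2l ?Glj // subr_ge0.
exists mu; split=> // j; rewrite leq_eqVlt => /orP[/eqP->|]; last exact: Gj.
(* Two consecutive zeros of [G] would force [S mu m.+1 = 0], but this decrement is positive. *)
rewrite lt_neqAle Gm1 andbT eq_sym; apply/eqP => Gm10.
have : 0 < S mu m.+1.
  apply: radialS_gt0 => // i; rewrite leq_eqVlt => /orP[/eqP->//|/Gj/ltW//].
by move: Gmu; rewrite radialGS Gm10 sub0r => /eqP; rewrite oppr_eq0 => /eqP->; rewrite ltxx.
Qed.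

(** * Bounds on the first Dirichlet eigenvalue of a branch *)

Hypothesis d2 : (2 <= d)%N.
Let D : R := d%:R - 1.

Let D1 : 1 <= D.
Proof. by have h2 : 2%:R <= d%:R :> R by [rewrite ler_nat]; rewrite /D; lra. Qed.

Let D0 : 0 < D. Proof. exact: lt_le_trans ltr01 D1. Qed.

Variables (l : R) (h : nat).
Hypotheses (l0 : 0 < l) (Gh : G l h.+1 = 0) (Gpos : forall j, (j <= h)%N -> 0 < G l j).

Let Gge0 j : (j <= h.+1)%N -> 0 <= G l j.
Proof. by rewrite leq_eqVlt => /orP[/eqP->|/Gpos/ltW]; rewrite ?Gh. Qed.

Let Sgt0 j : (j <= h.+1)%N -> 0 < S l j.
Proof.
move=> jh; apply: radialS_gt0 => // [|i ij]; first exact: ltnW.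
by apply: Gge0; rewrite (leq_trans ij).
Qed.

Lemma radial_le1 j : (j <= h.+1)%N -> G l j <= 1.
Proof.
elim: j => [|j IH] jh; first by rewrite radialG0.
rewrite radialGS; have := Sgt0 (ltnW jh); have := IH (ltnW jh); lra.
Qed.

Lemma radialS_le j : (j <= h.+1)%N -> S l j * D <= l * (d%:R ^+ j.+1 - 1).
Proof.
elim: j => [|j IH] jh; first by rewrite radialS0 expr1.
rewrite radialSS mulrDl.
have : d%:R * (S l j * D) <= d%:R * (l * (d%:R ^+ j.+1 - 1)).
  by rewrite ler_wpM2l // IH // ltnW.
have : l * G l j.+1 * D <= l * D.
  by rewrite ler_wpM2r ?(ltW D0) // ler_piMr ?(ltW l0) // radial_le1.
by rewrite [_ ^+ j.+2]exprS /D; lra.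
Qed.

(** The decrements, bounded in [radialS_le] by means of [G <= 1], are summed; at [h.+1], where [G]
    vanishes, this bounds [l] from below. *)
Lemma radialG_ge j : (j <= h.+1)%N -> D ^+ 2 - l * d%:R ^+ j.+1 <= G l j * D ^+ 2.
Proof.
elim: j => [|j IH] jh.
  by rewrite radialG0 mul1r gerBl mulr_ge0 ?exprn_ge0 // ltW.
have := IH (ltnW jh).
have : S l j * D ^+ 2 <= l * d%:R ^+ j.+1 * D.
  rewrite expr2 mulrA ler_wpM2r ?(ltW D0) // (le_trans (radialS_le (ltnW jh))) //.
  by rewrite ler_wpM2l ?(ltW l0) // gerBl.
by rewrite radialGS [_ ^+ j.+2]exprS /D; lra.
Qed.

Lemma radial_eigenvalue_ge : D ^+ 2 / d%:R ^+ h.+2 <= l.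
Proof.
have := radialG_ge (leqnn h.+1); rewrite Gh mul0r subr_le0 => le1.
by rewrite ler_pdivrMr // exprn_gt0 // ltr0n ltnW.
Qed.

(** A crude bound, needed to control the terms quadratic in [l] below. As [G] decreases,
    [S l j >= l * d^j * G l j]; at [j = h] the decrement equals the value [G l h] itself. *)
Lemma radial_eigenvalue_le_inv : l * d%:R ^+ h <= 1.
Proof.
have SG j : (j <= h.+1)%N -> l * d%:R ^+ j * G l j <= S l j.
  elim: j => [|j IH] jh; first by rewrite radialG0 radialS0 expr0 !mulr1.
  rewrite radialSS; apply: ler_wpDr; first by rewrite mulr_ge0 ?(ltW l0) ?Gge0.
  have := IH (ltnW jh); rewrite exprS => le1.
  have : d%:R * (l * d%:R ^+ j * G l j) <= d%:R * S l j by rewrite ler_wpM2l.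
  apply: le_trans.
  rewrite [leLHS](_ : _ = d%:R * (l * d%:R ^+ j * G l j.+1)); last by ring.
  rewrite ler_wpM2l // ler_wpM2l ?mulr_ge0 ?exprn_ge0 ?(ltW l0) //.
  by rewrite radialGS gerBl ltW // Sgt0 // ltnW.
have := SG h (leqnSn h); move: Gh; rewrite radialGS => /eqP.
by rewrite subr_eq0 => /eqP <-; rewrite ger_pMl // Gpos.
Qed.

(** Second pass through the recursion: the lower bound on [G] replaces [G <= 1], at the cost of a
    term of second order in [l]. *)
Lemma radialS_ge j : (j <= h.+1)%N ->
  l * (D * (d%:R ^+ j.+1 - 1) - l * (j.+1%:R * d%:R ^+ j.+1)) <= S l j * D ^+ 2.
Proof.
elim: j => [|j IH] jh.
  rewrite radialS0 expr1 mul1r ler_wpM2l ?(ltW l0) // -expr2 gerBl.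
  by rewrite mulr_ge0 // ltW.
have : l * (D ^+ 2 - l * d%:R ^+ j.+2) <= l * (G l j.+1 * D ^+ 2).
  by rewrite ler_wpM2l ?(ltW l0) // radialG_ge.
have : d%:R * (l * (D * (d%:R ^+ j.+1 - 1) - l * (j.+1%:R * d%:R ^+ j.+1)))
    <= d%:R * (S l j * D ^+ 2).
  by rewrite ler_wpM2l // IH // ltnW.
rewrite radialSS ![_ ^+ j.+2]exprS -[j.+2%:R]natr1 /D; lra.
Qed.

Lemma radialG_le j : (j <= h.+1)%N ->
  l * (D * (d%:R ^+ j.+1 - d%:R - j%:R * D) - l * (j%:R * d%:R ^+ j.+1))
    <= (1 - G l j) * D ^+ 3.
Proof.
elim: j => [|j IH] jh.
  by rewrite radialG0 expr1 !subrr !mul0r !subr0 !mulr0 subrr mulr0.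
have := IH (ltnW jh).
have : l * (D * (d%:R ^+ j.+1 - 1) - l * (j.+1%:R * d%:R ^+ j.+1)) * D
    <= S l j * D ^+ 2 * D.
  by rewrite ler_wpM2r ?(ltW D0) // radialS_ge // ltnW.
have : 0 <= l * l * d%:R ^+ j.+1 by rewrite !mulr_ge0 ?exprn_ge0 // ltW.
rewrite radialGS [_ ^+ j.+2]exprS -[j.+1%:R]natr1.
have -> : d%:R = D + 1 by rewrite /D subrK.
lra.
Qed.

Lemma radial_eigenvalue_le :
  l <= D ^+ 2 / d%:R ^+ h.+2 +
       (d%:R ^+ 2 + 2 * d%:R) * h.+1%:R / (d%:R ^+ h.+1) ^+ 2.
Proof.
have := radialG_le (leqnn h.+1); rewrite Gh subr0 mul1r.
have := radial_eigenvalue_le_inv.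
have : 1 <= h.+1%:R :> R by rewrite ler1n.
set H : R := h.+1%:R => H1.
have d0 : 0 < d%:R :> R by rewrite ltr0n ltnW.
have q0 : 0 < d%:R ^+ h.+1 :> R by rewrite exprn_gt0.
rewrite -(ler_pM2l d0) mulr1 mulrCA -exprS [_ ^+ h.+2]exprS.
set q := d%:R ^+ h.+1 in q0 *.
have -> : d%:R = D + 1 by rewrite /D subrK.
move=> lq main.
rewrite -(ler_pM2r (exprn_gt0 2 q0)) mulrDl divfK ?gt_eqF ?exprn_gt0 //.
have D10 : 0 < D + 1 by rewrite addr_gt0.
rewrite [X in _ <= X + _](_ : _ = D ^+ 2 * q / (D + 1)); last first.
  by field; rewrite !gt_eqF.
rewrite -(ler_pM2r D10) mulrDl divfK ?gt_eqF //.
have lq0 : 0 <= l * q by rewrite mulr_ge0 ?ltW.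
have H0 : 0 <= H := le_trans ler01 H1.
(* [e1] and [e2] bound, through [l * q <= d], the two error terms of [main] multiplied by [q];
   together they give [D * d] times [(d^2 + 2 d) * H]. *)
have e1 : l * q * D * (D + 1 + H * D) <= (D + 1) * D * (2 * (D + 1) * H).
  have DH : 0 <= D * (H - 1) by rewrite (mulr_ge0 (ltW D0)) // subr_ge0.
  apply: ler_pM; last by lra.
  - by rewrite mulr_ge0 // ltW.
  - by rewrite addr_ge0 ?mulr_ge0 ?(ltW D0) // ltW.
  - by rewrite ler_wpM2r // ltW.
have e2 : (l * q) ^+ 2 * (D + 1) * H <= D * (D + 1) ^+ 3 * H.
  rewrite ler_wpM2r //; apply: (@le_trans _ _ ((D + 1) ^+ 3)).
    by rewrite [leRHS]exprSr ler_wpM2r ?lerXn2r ?nnegrE ?(ltW D10).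
  by rewrite ler_peMl ?exprn_ge0 ?(ltW D10).
rewrite -(ler_pM2l D0); have := ler_wpM2r (ltW q0) main.
by move: e1 e2; lra.
Qed.
End Radial.

(** The radial solution reindexed by the depth in a tree of height [h.+1]: 0 at the root, 1 at the
    leaves. *)
Lemma exists_radial_profile (R : rcfType) (d h : nat) : (2 <= d)%N ->
  exists (l : R) (g : nat -> R),
  [/\ 0 < l, l * d%:R ^+ h <= 1,
      (d%:R - 1) ^+ 2 / d%:R ^+ h.+2 <= l &
      l <= (d%:R - 1) ^+ 2 / d%:R ^+ h.+2 +
           (d%:R ^+ 2 + 2 * d%:R) * h.+1%:R / (d%:R ^+ h.+1) ^+ 2] /\
  [/\ g 0%N = 0, g h.+1 = 1,
      forall k, (0 < k <= h.+1)%N -> 0 < g k <= 1,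
      forall k, (0 < k <= h)%N -> g k - g k.-1 + d%:R * (g k - g k.+1) = l * g k &
      g h.+1 - g h = l * g h.+1].
Proof.
move=> d2; have [l [l0 Gl Gpos]] := radial_root R h (ltnW d2).
exists l, (fun k => (radial R d (h.+1 - k)).1.[l]); split.
  split=> //; first exact: radial_eigenvalue_le_inv Gl Gpos.
    exact: radial_eigenvalue_ge Gl Gpos.
  exact: radial_eigenvalue_le Gl Gpos.
split.
- by rewrite subn0.
- by rewrite subnn radialG0.
- move=> k /andP[k0 kh]; rewrite (radial_le1 d2 l0 Gl Gpos) ?leq_subr // andbT.
  by apply: Gpos; rewrite leq_subLR; case: k k0 kh => // k _ _; rewrite addSn ltnS leq_addl.
- case=> // k /andP[_ kh]; rewrite /= !subSS.
  rewrite subSn; last exact: ltnW.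
  rewrite -(subnSK kh); set j := (h - k.+1)%N.
  rewrite 2!radialGS radialSS radialGS; ring.
by rewrite subnn subSn // subnn radialGS radialG0 radialS0 mulr1 opprB addrC subrK.
Qed.

(** * The Laplacian of a rooted tree *)

Section TreeLaplacian.
Variables (R : realFieldType) (V : finType) (r : V) (p : V -> V).
Hypothesis p_neq : forall v, v != r -> p v != v.

(** Summed over all edges, those not containing [x] contributing 0: this is the form in which the
    interchange step produces it. *)
Definition laplacian (f : V -> R) (x : V) : R :=
  \sum_(v | v != r) (f x - f (tperm (p v) v x)).

Lemma laplacianE f x : laplacian f x =
  (if x == r then 0 else f x - f (p x)) +
  \sum_(v | (v != r) && (p v == x)) (f x - f v).
Proof.
rewrite /laplacian (bigID (fun v => v == x)) /=; congr (_ + _).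
  case: eqVneq => [->|xr].
    by rewrite big_pred0 // => v; case: eqVneq => // ->; rewrite andbF.
  rewrite (big_pred1 x) => [|v]; first by rewrite tpermR.
  by rewrite /= ; case: (eqVneq v x) => [->|]; rewrite ?xr ?andbF.
rewrite (bigID (fun v => p v == x)) /= [X in _ + X]big1 ?addr0 => [|v].
  apply: eq_big => [v|v /andP[_ /eqP<-]]; last by rewrite tpermL.
  case: (eqVneq v r) => //= vr.
  by case: (eqVneq (p v) x) => [<-|]; rewrite ?andbF ?andbT // eq_sym p_neq.
by move=> /andP[/andP[_ vx] pvx]; rewrite tpermD ?subrr.
Qed.

(** Summation by parts: the edge of [v] is seen only from its two ends. *)
Lemma sum_mul_laplacian (a f : V -> R) : \sum_x a x * laplacian f x =
  \sum_(v | v != r) (a (p v) - a v) * (f (p v) - f v).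
Proof.
under eq_bigr do rewrite mulr_sumr.
rewrite exchange_big /=; apply: eq_bigr => v vr.
rewrite (bigD1 (p v)) //= (bigD1 v) 1?eq_sym ?p_neq //= big1 => [|x /andP[xpv xv]].
  by rewrite tpermL tpermR; ring.
by rewrite tpermD 1?eq_sym // subrr mulr0.
Qed.

Variables (psi : V -> R) (lam : R).
Hypotheses (psi_r : psi r = 0) (psi_gt0 : forall v, v != r -> 0 < psi v).
Hypothesis psi_lap : forall v, v != r -> laplacian psi v = lam * psi v.

(* Barta's argument: test the Laplacian of the positive eigenfunction psi
   against f ^+ 2 / psi (which is 0 at the root, where psi vanishes). *)
Lemma barta (f : V -> R) : f r = 0 ->
  lam * \sum_v f v ^+ 2 <= \sum_(v | v != r) (f (p v) - f v) ^+ 2.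
Proof.
move=> fr.
have -> : lam * \sum_v f v ^+ 2 = \sum_v (f v ^+ 2 / psi v) * laplacian psi v.
  rewrite mulr_sumr; apply: eq_bigr => v _.
  have [->|vr] := eqVneq v r; first by rewrite fr expr0n /= !mul0r mulr0.
  by rewrite psi_lap //; field; rewrite gt_eqF // psi_gt0.
rewrite sum_mul_laplacian; apply: ler_sum => v vr.
have pv := psi_gt0 vr.
have [->|ppr] := eqVneq (p v) r.
  rewrite psi_r fr expr0n mul0r !sub0r sqrrN mulrNN.
  by rewrite divfK // gt_eqF.
have pp := psi_gt0 ppr; rewrite -subr_ge0.
set x := psi v in pv *; set y := psi (p v) in pp *.
(* Picone's identity: on each edge the defect is a square. *)
rewrite (_ : _ - _ = x * y * (f (p v) / y - f v / x) ^+ 2).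
  by rewrite mulr_ge0 ?sqr_ge0 // ltW // mulr_gt0.
by field; rewrite !gt_eqF.
Qed.

(** Barta's inequality is applied to [phi - phi r], which vanishes at the root; for centered [phi]
    this shift can only increase the sum of squares. *)
Lemma vertex_poincare_barta : 0 <= lam -> vertex_poincare r p [set: V] lam.
Proof.
move=> lam0 phi; under eq_bigl do rewrite inE; move=> phi0.
under eq_bigl do rewrite inE; under [X in _ <= X]eq_bigl do rewrite !inE andbT.
have := barta (f := fun v => phi v - phi r); rewrite subrr => /(_ erefl).
under [X in _ <= X -> _]eq_bigr do rewrite opprB addrA subrK.
move=> /(le_trans _); apply; rewrite ler_wpM2l //.
rewrite -subr_ge0 -sumrB.
rewrite (eq_bigr (fun v => (- (phi r *+ 2)) * phi v + phi r ^+ 2)); last first.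
  by move=> v _; ring.
rewrite big_split /= -mulr_sumr phi0 mulr0 add0r.
by apply: sumr_ge0 => v _; rewrite sqr_ge0.
Qed.
End TreeLaplacian.

(** * The complete tree *)

Section CompleteTree.
Variables (d h : nat).
Local Notation V := (tree_vertex d h).
Implicit Types (u v x : V).

Definition tree_root : V := [bseq].

Definition tree_parent (v : V) : V := [bseq of take (size v).-1 v].

(** Meaningful only when [size v < h]; otherwise [insub_bseq] returns a default value. *)
Definition tree_child (v : V) (i : 'I_d) : V := insub_bseq h (rcons v i).

Lemma tree_root_size v : (v == tree_root) = (size v == 0)%N.
Proof. by rewrite -val_eqE /= size_eq0. Qed.

Lemma size_tree_parent v : size (tree_parent v) = (size v).-1.
Proof. by rewrite size_takel // leq_pred. Qed.

Lemma tree_child_val v i : (size v < h)%N -> tree_child v i = rcons v i :> seq _.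
Proof. by move=> vh; rewrite /tree_child /insub_bseq insubdK // unfold_in size_rcons. Qed.

Lemma tree_childK v i : (size v < h)%N -> tree_parent (tree_child v i) = v.
Proof.
move=> vh; apply: val_inj => /=.
by rewrite tree_child_val // size_rcons /= -cats1 take_size_cat.
Qed.

Lemma tree_vertexP v : v != tree_root ->
  exists i, bseqval v = rcons (tree_parent v) i.
Proof.
rewrite tree_root_size /tree_parent /=; case: v => s /= _.
by case/lastP: s => // s i _; exists i; rewrite size_rcons /= -{2}cats1 take_size_cat.
Qed.

Lemma tree_parent_lt v : v != tree_root -> (size (tree_parent v) < size v)%N.
Proof. by rewrite size_tree_parent tree_root_size; case: (size v). Qed.

Lemma tree_parent_neq v : v != tree_root -> tree_parent v != v.
Proof. by move=> /tree_parent_lt; apply: contraTneq => ->; rewrite ltnn. Qed.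

Lemma tree_edgesE :
  tree_edges d h = [set (tree_parent v, v) | v in [set~ tree_root]]%SET.
Proof.
apply/finset.setP => -[u v]; rewrite inE /=; apply/existsP/imsetP => /=.
  case=> i /eqP vE; have uE : u = tree_parent v.
    by apply: val_inj; rewrite /= vE size_rcons /= -cats1 take_size_cat.
  exists v; last by rewrite uE.
  by rewrite !inE tree_root_size vE size_rcons.
case=> w; rewrite !inE => wr [-> ->].
by have [i wE] := tree_vertexP wr; exists i; rewrite [in X in X == _]wE.
Qed.

Lemma sum_tree_edges (R : nmodType) (F : V * V -> R) :
  \sum_(e in tree_edges d h) F e = \sum_(v | v != tree_root) F (tree_parent v, v).
Proof.
rewrite tree_edgesE big_imset /= => [|u v _ _ []//].
by apply: eq_bigl => v; rewrite !inE.
Qed.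

Lemma sum_tree_children (R : nmodType) (F : V -> R) x :
  \sum_(v | (v != tree_root) && (tree_parent v == x)) F v =
  if (size x < h)%N then \sum_(i < d) F (tree_child x i) else 0.
Proof.
case: ifPn => xh; last first.
  rewrite big_pred0 // => v; apply: contraNF xh => /andP[vr /eqP<-].
  exact: leq_trans (tree_parent_lt vr) (size_bseq v).
rewrite -(big_imset (h := tree_child x)) /= => [|i j _ _ /(congr1 val)/=]; last first.
  by rewrite !tree_child_val // => /rcons_inj[].
apply: eq_bigl => v; apply/andP/imsetP => [[vr /eqP<-]|[i _ ->]].
  have [i vE] := tree_vertexP vr; exists i => //; apply: val_inj.
  by rewrite /= tree_child_val ?(leq_trans (tree_parent_lt vr) (size_bseq v)).
by rewrite tree_root_size tree_child_val // size_rcons tree_childK.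
Qed.

Variable (R : realFieldType).

(** The first letter of [v] names the branch at the root that contains [v], and [a] gives the
    coefficient of [g] on each branch. *)
Definition radial_fun (a : 'I_d -> R) (g : nat -> R) (v : V) : R :=
  if bseqval v is c :: _ then a c * g (size v) else 0.

Lemma radial_fun_root a g : radial_fun a g tree_root = 0. Proof. by []. Qed.

Lemma radial_fun_rcons a g u v i : bseqval v = rcons u i ->
  radial_fun a g v = (if bseqval u is c :: _ then a c else a i) * g (size u).+1.
Proof. by rewrite /radial_fun => ->; case: u => -[]//= c s _; rewrite size_rcons. Qed.

Lemma laplacian_radial_fun a g l : g 0%N = 0 ->
  (forall k, (0 < k < h)%N -> g k - g k.-1 + d%:R * (g k - g k.+1) = l * g k) ->
  g h - g h.-1 = l * g h ->
  forall x, x != tree_root ->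
  laplacian tree_root tree_parent (radial_fun a g) x = l * radial_fun a g x.
Proof.
move=> g0 gk gh x xr; rewrite laplacianE; last exact: tree_parent_neq.
rewrite (negPf xr) sum_tree_children.
have x0 : (0 < size x)%N by rewrite lt0n -tree_root_size.
pose A := if bseqval x is c :: _ then a c else 0.
have fx : radial_fun a g x = A * g (size x).
  by rewrite /radial_fun /A; case: bseqval => //; rewrite mul0r.
(* The parent lies in the same branch or is the root, where the value 0 is [A * g 0] because
   [g 0 = 0]. *)
have fpx : radial_fun a g (tree_parent x) = A * g (size x).-1.
  have [i xE] := tree_vertexP xr.
  rewrite -size_tree_parent /radial_fun /A xE.
  case: (bseqval (tree_parent x)) => //=; by rewrite g0 mulr0.
have fcx i : (size x < h)%N -> radial_fun a g (tree_child x i) = A * g (size x).+1.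
  move=> xh; rewrite (radial_fun_rcons _ _ (tree_child_val i xh)) /A.
  by move: x0; case: bseqval.
rewrite fx fpx mulrCA; case: ifPn => xh.
  under eq_bigr do rewrite fcx //.
  by rewrite sumr_const card_ord -mulr_natl -gk ?x0 //; ring.
have -> : size x = h.
  by apply/eqP; rewrite eqn_leq size_bseq leqNgt.
by rewrite -gh; ring.
Qed.

(** The flows from the branches into the root cancel. *)
Lemma laplacian_radial_fun_root a g l : (0 < h)%N -> \sum_i a i = 0 ->
  laplacian tree_root tree_parent (radial_fun a g) tree_root =
  l * radial_fun a g tree_root.
Proof.
move=> h0 a0; rewrite laplacianE; last exact: tree_parent_neq.
rewrite eqxx add0r sum_tree_children radial_fun_root mulr0 h0.
under eq_bigr => i _ do
  rewrite (radial_fun_rcons _ _ (tree_child_val i (h0 : (size tree_root < h)%N))) sub0r.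
by rewrite sumrN -mulr_suml a0 mul0r oppr0.
Qed.
End CompleteTree.

(** * The interchange chain *)

Lemma perm_onT (V : finType) (g : {perm V}) : perm_on [set: V]%SET g.
Proof. by apply/fintype.subsetP => x _; rewrite finset.in_setT. Qed.

Lemma card_perm_type (V : finType) : #|{perm V}| = (#|V|)`!.
Proof.
rewrite -[#|V|]cardsT -card_perm; apply: eq_card => g.
rewrite inE; exact: (esym (perm_onT g)).
Qed.

Section InterchangeChain.
Variables (R : realType) (V : finType) (E : {set V * V}).
Implicit Types (F : {perm V} -> R) (g : {perm V}).
Local Notation swap e := (tperm e.1 e.2).

Definition interchange_step F g : R :=
  \sum_(e in E) #|E|%:R^-1 * (2^-1 * F (swap e * g)%g + 2^-1 * F g).

Definition interchange_mean (t : nat) F : R :=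
  \sum_g interchange_law R E t g * F g.

Lemma sum_interchange_prob F g :
  \sum_g' interchange_prob R E g g' * F g' = interchange_step F g.
Proof.
under eq_bigr do rewrite /interchange_prob mulr_suml.
rewrite exchange_big /=; apply: eq_bigr => e _.
under eq_bigr do rewrite -mulrA mulrDl -!mulrA.
rewrite -mulr_sumr big_split /= -!mulr_sumr; congr (_ * (_ * _ + _ * _)).
  rewrite (bigD1 (swap e * g)%g) //= eqxx mul1r big1 ?addr0 // => g' /negPf->.
  by rewrite mul0r.
by rewrite (bigD1 g) //= eqxx mul1r big1 ?addr0 // => g' /negPf->; rewrite mul0r.
Qed.

Lemma interchange_probC g g' : interchange_prob R E g g' = interchange_prob R E g' g.
Proof.
apply: eq_bigr => e _; rewrite [g == g']eq_sym.
suff -> : (g' == swap e * g)%g = (g == swap e * g')%g by [].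
by apply/eqP/eqP => ->; rewrite mulgA tperm2 mul1g.
Qed.

Lemma sum_enum_perm (F : 'I_#|{perm V}| -> R) : \sum_i F i = \sum_g F (enum_rank g).
Proof. by rewrite (reindex _ (onW_bij _ (enum_rank_bij _))). Qed.

Lemma sum_swap e F : \sum_g F (swap e * g)%g = \sum_g F g.
Proof. by rewrite [RHS](reindex_inj (mulgI (swap e))). Qed.

Lemma interchange_mean0 F : interchange_mean 0 F = F 1%g.
Proof.
rewrite /interchange_mean (bigD1 1%g) //= big1 => [|g g1].
  by rewrite /interchange_law expr0 mxE eqxx mul1r addr0.
rewrite /interchange_law expr0 mxE (inj_eq enum_rank_inj) eq_sym (negPf g1).
by rewrite mul0r.
Qed.

Lemma interchange_meanS t F :
  interchange_mean t.+1 F = interchange_mean t (interchange_step F).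
Proof.
rewrite /interchange_mean.
under eq_bigr => g _ do rewrite /interchange_law exprSr -mulmxE mxE mulr_suml.
rewrite exchange_big /= sum_enum_perm; apply: eq_bigr => g _.
rewrite -sum_interchange_prob mulr_sumr; apply: eq_bigr => g' _.
by rewrite mxE !enum_rankK mulrA.
Qed.

Hypothesis E0 : (0 < #|E|)%N.

Let m0 : 0 < #|E|%:R :> R. Proof. by rewrite ltr0n. Qed.

Lemma interchange_stepE F g : interchange_step F g =
  F g - (2 * #|E|%:R)^-1 * \sum_(e in E) (F g - F (swap e * g)%g).
Proof.
rewrite /interchange_step.
rewrite (eq_bigr (fun e => #|E|%:R^-1 * F g +
   - (2 * #|E|%:R)^-1 * (F g - F (swap e * g)%g))); last first.
  by move=> e _; field; rewrite gt_eqF.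
rewrite big_split /= sumr_const -mulr_sumr mulNr; congr (_ - _).
by rewrite -[LHS]mulr_natr; field; rewrite gt_eqF.
Qed.

Lemma interchange_step_cst (c : R) g : interchange_step (fun=> c) g = c.
Proof. by rewrite interchange_stepE big1 ?mulr0 ?subr0 // => e _; rewrite subrr. Qed.

Lemma sum_interchange_step F : \sum_g interchange_step F g = \sum_g F g.
Proof.
under eq_bigr do rewrite interchange_stepE.
rewrite sumrB -mulr_sumr exchange_big /= [X in _ * X]big1 ?mulr0 ?subr0 // => e _.
by rewrite sumrB sum_swap subrr.
Qed.

Lemma sum_mul_interchange_step F : \sum_g F g * interchange_step F g =
  \sum_g F g ^+ 2 -
  (4 * #|E|%:R)^-1 * \sum_(e in E) \sum_g (F (swap e * g)%g - F g) ^+ 2.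
Proof.
transitivity (\sum_g F g ^+ 2 - (2 * #|E|%:R)^-1 *
    \sum_(e in E) \sum_g F g * (F g - F (swap e * g)%g)).
  rewrite exchange_big mulr_sumr -sumrB; apply: eq_bigr => g _.
  by rewrite interchange_stepE -mulr_sumr; ring.
congr (_ - _); rewrite !mulr_sumr; apply: eq_bigr => e _.
rewrite [X in _ = _ * X](eq_bigr (fun g => (F (swap e * g)%g ^+ 2 - F g ^+ 2) +
   2 * (F g * (F g - F (swap e * g)%g)))); last by move=> g _; ring.
rewrite [X in _ = _ * X]big_split /= sumrB (sum_swap e (fun g => F g ^+ 2)).
rewrite subrr add0r -mulr_sumr.
by field; rewrite gt_eqF.
Qed.

(** The fair coin makes each edge move an average of the identity and a swap, hence a projection. So
    no eigenvalue is negative, and absolute values do not matter in the gap. *)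
Lemma sum_mul_interchange_step_ge0 F : 0 <= \sum_g F g * interchange_step F g.
Proof.
have -> : \sum_g F g * interchange_step F g =
   \sum_(e in E) (4 * #|E|%:R)^-1 * \sum_g (F (swap e * g)%g + F g) ^+ 2.
  under eq_bigr do rewrite /interchange_step mulr_sumr.
  rewrite exchange_big; apply: eq_bigr => e _.
  rewrite mulr_sumr; apply/eqP; rewrite -subr_eq0 -sumrB.
  rewrite (eq_bigr (fun g => (4 * #|E|%:R)^-1 * F g ^+ 2 -
     (4 * #|E|%:R)^-1 * F (swap e * g)%g ^+ 2)); last first.
    by move=> g _; field; rewrite gt_eqF.
  rewrite sumrB (sum_swap e (fun g => (4 * #|E|%:R)^-1 * F g ^+ 2)).
  by rewrite subrr.
apply: sumr_ge0 => e _; rewrite mulr_ge0 ?invr_ge0 ?mulr_ge0 ?ler0n //.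
by apply: sumr_ge0 => g _; rewrite sqr_ge0.
Qed.

(** [eigenvalue] refers to row vectors; by symmetry of the transition matrix they evolve like
    functions. *)
Lemma mulmx_interchange (v : 'rV[R]_#|{perm V}|) g :
  (v *m interchange_mx R E) 0 (enum_rank g) =
  interchange_step (fun g' => v 0 (enum_rank g')) g.
Proof.
rewrite mxE sum_enum_perm -sum_interchange_prob; apply: eq_bigr => g' _.
by rewrite mxE !enum_rankK interchange_probC mulrC.
Qed.

(** * The gap from a Poincare inequality and an eigenfunction *)

Section Gap.
Variables (l : R) (F0 : {perm V} -> R) (g0 : {perm V}).
Let gam := l / (2 * #|E|%:R).
Hypothesis gam01 : 0 < gam <= 1.
Hypothesis poincare : forall f : {perm V} -> R, \sum_g f g = 0 ->
  l * (2 * \sum_g f g ^+ 2) <= \sum_(e in E) \sum_g (f (swap e * g)%g - f g) ^+ 2.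
Hypothesis F0_eig : forall g, interchange_step F0 g = (1 - gam) * F0 g.
Hypothesis F0_neq0 : F0 g0 != 0.

Lemma eigenvalue_interchange_le mu :
  eigenvalue (interchange_mx R E) mu -> mu != 1 -> `|mu| <= 1 - gam.
Proof.
move=> /eigenvalueP[v vP v0] mu1.
pose f g := v 0 (enum_rank g).
have fP g : interchange_step f g = mu * f g by rewrite -mulmx_interchange vP mxE.
(* The step preserves the total sum, so an eigenfunction with [mu != 1] is centered. *)
have sf : \sum_g f g = 0.
  have /eqP := sum_interchange_step f.
  under eq_bigr do rewrite fP.
  rewrite -mulr_sumr -subr_eq0 -[X in _ - X]mul1r -mulrBl mulf_eq0 subr_eq0.
  by rewrite (negPf mu1) => /eqP.
have sf2 : 0 < \sum_g f g ^+ 2.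
  have [i vi] : exists i, v 0 i != 0.
    by apply/rV0Pn.
  rewrite (bigD1 (enum_val i)) //= ltr_pwDl //.
    by rewrite lt_neqAle sqr_ge0 andbT eq_sym expf_neq0 // /f enum_valK.
  by apply: sumr_ge0 => g _; rewrite sqr_ge0.
have fPf : \sum_g f g * interchange_step f g = mu * \sum_g f g ^+ 2.
  by rewrite mulr_sumr; apply: eq_bigr => g _; rewrite fP; ring.
have mu0 : 0 <= mu.
  by rewrite -(pmulr_lge0 _ sf2) -fPf sum_mul_interchange_step_ge0.
rewrite ger0_norm // -(ler_pM2r sf2) -fPf sum_mul_interchange_step mulrBl mul1r.
rewrite lerD2l lerN2.
have k0 : 0 <= (4 * #|E|%:R)^-1 :> R by rewrite invr_ge0 mulr_ge0 ?ler0n.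
apply: le_trans (ler_wpM2l k0 (poincare sf)); rewrite le_eqVlt; apply/orP; left; apply/eqP.
by rewrite /gam; field; rewrite gt_eqF.
Qed.

Lemma eigenvalue_interchange : eigenvalue (interchange_mx R E) (1 - gam).
Proof.
apply/eigenvalueP; exists (\row_i F0 (enum_val i)).
  apply/rowP => i; rewrite -(enum_valK i) mulmx_interchange !mxE enum_rankK.
  by rewrite -F0_eig; congr interchange_step; apply/funext => g; rewrite mxE enum_rankK.
by apply/rV0Pn; exists (enum_rank g0); rewrite mxE enum_rankK.
Qed.

Lemma spectral_gap_interchange : spectral_gap (interchange_mx R E) = gam.
Proof.
have /andP[g0' g1] := gam01.
rewrite /spectral_gap.
set A := (X in sup X).
have ubA : ubound A (1 - gam).
  by move=> _ [mu [emu mu1] <-]; exact: eigenvalue_interchange_le.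
have inA : A (1 - gam).
  exists (1 - gam); last by rewrite ger0_norm // subr_ge0.
  split; first exact: eigenvalue_interchange.
  by rewrite lt_eqF // gtrBl.
suff -> : sup A = 1 - gam by rewrite subKr.
apply/eqP; rewrite eq_le; apply/andP; split.
  by apply: ge_sup => //; exists (1 - gam).
by apply: ub_le_sup => //; exists (1 - gam).
Qed.
End Gap.

(** * Wilson's lower bound on the total variation distance *)

Section Wilson.
Variables (Phi : {perm V} -> R) (gam B : R).
Hypotheses (gam0 : 0 < gam) (gam2 : 2 * gam <= 1) (B0 : 0 <= B).
Hypothesis Phi_eig : forall g, interchange_step Phi g = (1 - gam) * Phi g.
Hypothesis Phi_var : forall g,
  (2 * #|E|%:R)^-1 * \sum_(e in E) (Phi (swap e * g)%g - Phi g) ^+ 2 <= 2 * gam * B.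

Lemma interchange_law_ge0 t g : 0 <= interchange_law R E t g.
Proof.
elim: t g => [|t IH] g; first by rewrite /interchange_law expr0 mxE ler0n.
rewrite /interchange_law exprSr -mulmxE mxE sum_enum_perm.
apply: sumr_ge0 => g' _; rewrite mulr_ge0 ?IH // mxE.
apply: sumr_ge0 => e _; rewrite mulr_ge0 ?invr_ge0 ?ler0n // addr_ge0 //;
  by rewrite mulr_ge0 ?invr_ge0 ?ler0n.
Qed.

Lemma interchange_mean_cst t (c : R) : interchange_mean t (fun=> c) = c.
Proof.
elim: t => [|t IH]; first by rewrite interchange_mean0.
rewrite interchange_meanS -[RHS]IH; congr interchange_mean.
by apply/funext => g; rewrite interchange_step_cst.
Qed.

Lemma interchange_mean_le t F G : (forall g, F g <= G g) ->
  interchange_mean t F <= interchange_mean t G.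
Proof.
by move=> FG; apply: ler_sum => g _; rewrite ler_wpM2l // interchange_law_ge0.
Qed.

Lemma interchange_mean_affine t F G (a b c : R) :
  interchange_mean t (fun g => a * F g + b * G g + c) =
  a * interchange_mean t F + b * interchange_mean t G + c.
Proof.
rewrite -{2}[c](interchange_mean_cst t) /interchange_mean !mulr_sumr -!big_split.
by apply: eq_bigr => g _ /=; ring.
Qed.

Lemma interchange_mean_eig t :
  interchange_mean t Phi = (1 - gam) ^+ t * Phi 1%g.
Proof.
elim: t => [|t IH]; first by rewrite interchange_mean0 expr0 mul1r.
rewrite interchange_meanS exprS -mulrA -IH /interchange_mean mulr_sumr.
by apply: eq_bigr => g _; rewrite Phi_eig; ring.
Qed.

(** The new square is the old one, plus [2 * Phi g] times the mean increment [- gam * Phi g], plus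
    the mean squared increment, bounded by [Phi_var]. *)
Lemma interchange_step_sqr_le g :
  interchange_step (fun g => Phi g ^+ 2) g <= (1 - 2 * gam) * Phi g ^+ 2 + 2 * gam * B.
Proof.
apply: le_trans (lerD (lexx _) (Phi_var g)).
rewrite le_eqVlt; apply/orP; left; apply/eqP.
have := Phi_eig g; rewrite !interchange_stepE; set k := (2 * _)^-1 => kPhi.
rewrite (eq_bigr (fun e => 2 * Phi g * (Phi g - Phi (swap e * g)%g) -
  (Phi (swap e * g)%g - Phi g) ^+ 2)) => [|e _]; last by ring.
rewrite sumrB -mulr_sumr; move: kPhi.
set s1 := \sum_(e in E) _; set s2 := \sum_(e in E) _ => kPhi.
have -> : Phi g ^+ 2 - k * (2 * Phi g * s1 - s2) =
  2 * Phi g * (Phi g - k * s1) - Phi g ^+ 2 + k * s2 by ring.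
by rewrite kPhi; ring.
Qed.

(** The variance stays at most [B]: [B] is the fixed point of the second moment recursion, and the
    squared mean shrinks by [(1 - gam)^2 >= 1 - 2 * gam]. *)
Lemma interchange_mean_sqr_le t : interchange_mean t (fun g => Phi g ^+ 2) <=
  interchange_mean t Phi ^+ 2 + B.
Proof.
elim: t => [|t IH]; first by rewrite !interchange_mean0 lerDl.
have le1 : interchange_mean t.+1 (fun g => Phi g ^+ 2) <=
    (1 - 2 * gam) * interchange_mean t (fun g => Phi g ^+ 2) + 2 * gam * B.
  rewrite interchange_meanS (le_trans (interchange_mean_le _ interchange_step_sqr_le)) //.
  have := interchange_mean_affine t (fun g => Phi g ^+ 2) (fun=> 0)
    (1 - 2 * gam) 0 (2 * gam * B).
  rewrite !mul0r addr0 => <-; apply: interchange_mean_le => g.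
  by rewrite addr0.
apply: (le_trans le1).
have : (1 - 2 * gam) * interchange_mean t (fun g => Phi g ^+ 2) <=
    (1 - 2 * gam) * (interchange_mean t Phi ^+ 2 + B).
  by rewrite ler_wpM2l // subr_ge0.
have : 0 <= gam ^+ 2 * interchange_mean t Phi ^+ 2.
  by rewrite mulr_ge0 ?sqr_ge0.
rewrite interchange_meanS.
have -> : interchange_mean t (interchange_step Phi) = (1 - gam) * interchange_mean t Phi.
  rewrite /interchange_mean mulr_sumr; apply: eq_bigr => g _.
  by rewrite Phi_eig; ring.
lra.
Qed.

(** The second moment under the uniform law: it is invariant, so the one-step inequality summed over
    all [g] bounds it directly. *)
Lemma sum_eig_sqr_le : \sum_g Phi g ^+ 2 <= B * (#|V|)`!%:R.
Proof.
have := @ler_sum R _ (index_enum {perm V}) xpredT _ _ (fun g _ => interchange_step_sqr_le g).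
rewrite sum_interchange_step big_split /= -mulr_sumr sumr_const.
rewrite card_perm_type; set s := \sum_g _; rewrite -[(2 * gam * B) *+ _]mulr_natr => le1.
rewrite -(ler_pM2l (_ : 0 < 2 * gam)); last by rewrite mulr_gt0.
by move: le1; lra.
Qed.

(* Chebyshev for the events [Phi g >= m / 2] under the law at time t, where Phi
   has mean m, and under the uniform law, where it has mean 0. *)
Lemma interchange_tv_ge t : 0 < Phi 1%g ->
  1 - 8 * B / ((1 - gam) ^+ t * Phi 1%g) ^+ 2 <= interchange_tv R E t.
Proof.
move=> Phi0; set m : R := (1 - gam) ^+ t * Phi 1%g.
have m0' : 0 < m.
  by rewrite mulr_gt0 // exprn_gt0 // subr_gt0; move: gam0 gam2; lra.
have mneq0 : m != 0 by rewrite gt_eqF.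
pose A g : R := ((m / 2 <= Phi g)%R : bool)%:R.
pose N : R := ((#|V|)`!)%:R^-1.
have N0 : 0 < N by rewrite invr_gt0 ltr0n fact_gt0.
have cardN : #|{perm V}|%:R * N = 1.
  by rewrite card_perm_type divff // pnatr_eq0 -lt0n fact_gt0.
have tvA : interchange_mean t A - \sum_g N * A g <= interchange_tv R E t.
  rewrite /interchange_tv mulr_sumr.
  (* Subtracting 1/2 from [A] is free, since the differences of the two laws sum to 0, and gives the
     factor 1/2 of the distance. *)
  have -> : interchange_mean t A - \sum_g N * A g =
      \sum_g (interchange_law R E t g - N) * (A g - 2^-1).
    under [RHS]eq_bigr do rewrite mulrBr.
    rewrite sumrB -mulr_suml.
    have -> : \sum_g (interchange_law R E t g - N) = 0.
      rewrite sumrB sumr_const -[N *+ _]mulr_natl cardN.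
      have := interchange_mean_cst t 1; rewrite /interchange_mean.
      by under eq_bigr do rewrite mulr1; move=> ->; rewrite subrr.
    rewrite mul0r subr0 -sumrB; apply: eq_bigr => g _; ring.
  apply: ler_sum => g _; rewrite -/N.
  set x := _ - N; have := ler_norm x; have := ler_norm (- x); rewrite normrN /A.
  by case: (m / 2 <= Phi g)%R => /=; lra.
apply: le_trans tvA.
have le1 : \sum_g N * A g <= 4 * B / m ^+ 2.
  apply: (@le_trans _ _ (\sum_g N * (4 / m ^+ 2) * Phi g ^+ 2)).
    apply: ler_sum => g _; rewrite -mulrA ler_wpM2l ?(ltW N0) // /A.
    case: (leP (m / 2) (Phi g)) => mP /=; last first.
      by rewrite mulr_ge0 ?sqr_ge0 // divr_ge0 // sqr_ge0.
    rewrite mulrAC ler_pdivlMr ?exprn_gt0 // mul1r.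
    have : (m / 2) ^+ 2 <= Phi g ^+ 2.
      by rewrite lerXn2r ?nnegrE // ?(le_trans _ mP) // divr_ge0 // ltW.
    by rewrite expr_div_n; lra.
  rewrite -mulr_sumr.
  apply: le_trans (ler_wpM2l _ sum_eig_sqr_le) _.
    by rewrite mulr_ge0 ?divr_ge0 ?sqr_ge0 // ltW.
  rewrite le_eqVlt; apply/orP; left; apply/eqP; rewrite /N.
  by field; rewrite mneq0 pnatr_eq0 -lt0n fact_gt0.
have le2 : 1 - 4 * B / m ^+ 2 <= interchange_mean t A.
  (* Chebyshev as a pointwise bound: the indicator dominates [1 - 4 * (Phi g - m)^2 / m^2], expanded
     here in [Phi^2] and [Phi]. *)
  have AP g : (- (4 / m ^+ 2)) * Phi g ^+ 2 + (8 / m) * Phi g + (- 3) <= A g.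
    have -> : (- (4 / m ^+ 2)) * Phi g ^+ 2 + (8 / m) * Phi g + (- 3) =
      1 - 4 / m ^+ 2 * (Phi g - m) ^+ 2 by field.
    rewrite /A; case: (leP (m / 2) (Phi g)) => mP /=.
      by rewrite gerBl mulr_ge0 ?sqr_ge0 // divr_ge0 // sqr_ge0.
    rewrite subr_le0 mulrAC ler_pdivlMr ?exprn_gt0 // mul1r.
    have : (m / 2) ^+ 2 <= (m - Phi g) ^+ 2.
      by rewrite lerXn2r ?nnegrE // ?divr_ge0 // ?(ltW m0') //; move: mP m0'; lra.
    by rewrite expr_div_n -(sqrrN (m - _)) opprB; lra.
  apply: le_trans (interchange_mean_le t AP).
  rewrite interchange_mean_affine.
  have Pm : interchange_mean t Phi = m := interchange_mean_eig t.
  have := interchange_mean_sqr_le t; rewrite Pm; set v := interchange_mean _ _ => vle.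
  have : 4 / m ^+ 2 * v <= 4 / m ^+ 2 * (m ^+ 2 + B).
    by rewrite ler_wpM2l // divr_ge0 // sqr_ge0.
  have -> : 4 / m ^+ 2 * (m ^+ 2 + B) = 4 + 4 * B / m ^+ 2 by field.
  rewrite divfK //; lra.
have -> : 8 * B / m ^+ 2 = 4 * B / m ^+ 2 + 4 * B / m ^+ 2 by field.
by move: le1 le2; lra.
Qed.
End Wilson.

(** * Eigenfunctions lifted from vertices to permutations *)

Section VertexEigenfunction.
Variables (phi psi : V -> R) (l : R).
Let gam := l / (2 * #|E|%:R).
Hypothesis phi_eig : forall x, \sum_(e in E) (phi x - phi (swap e x)) = l * phi x.
Let Phi g := \sum_x phi x * psi (g x).

Let Phi_swap e g : Phi (swap e * g)%g = \sum_x phi (swap e x) * psi (g x).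
Proof.
rewrite /Phi (reindex_inj (@perm_inj _ (swap e))) /=.
by apply: eq_bigr => x _; rewrite permM tpermK.
Qed.

(** After reindexing, a swap acts on [phi] alone, so [psi] is arbitrary: an indicator serves for the
    gap, [phi] itself for Wilson's method. *)
Lemma interchange_step_eig g : interchange_step Phi g = (1 - gam) * Phi g.
Proof.
rewrite interchange_stepE mulrBl mul1r; congr (_ - _).
rewrite (eq_bigr (fun e => \sum_x (phi x - phi (swap e x)) * psi (g x))); last first.
  by move=> e _; rewrite Phi_swap -sumrB; apply: eq_bigr => x _; rewrite mulrBl.
rewrite exchange_big /=; under eq_bigr do rewrite -mulr_suml phi_eig.
rewrite /gam [l / _]mulrC -mulrA; congr (_ * _); rewrite mulr_sumr.
by apply: eq_bigr => x _; rewrite mulrA.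
Qed.

Hypothesis psi_le1 : forall x, `|psi x| <= 1.
Hypothesis E_neq : forall e, e \in E -> e.1 != e.2.
Hypothesis phi_energy :
  \sum_(e in E) (phi e.1 - phi e.2) ^+ 2 = l * \sum_x phi x ^+ 2.

(** A swap at [u], [v] changes [Phi] by [phi v - phi u] times a difference of two values of [psi],
    which is at most 2 in absolute value. *)
Lemma interchange_eig_var g :
  (2 * #|E|%:R)^-1 * \sum_(e in E) (Phi (swap e * g)%g - Phi g) ^+ 2 <=
  2 * gam * (2 * \sum_x phi x ^+ 2).
Proof.
apply: (@le_trans _ _ ((2 * #|E|%:R)^-1 *
    \sum_(e in E) 4 * (phi e.1 - phi e.2) ^+ 2)); last first.
  by rewrite -mulr_sumr phi_energy /gam le_eqVlt; apply/orP; left; apply/eqP; ring.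
rewrite ler_wpM2l ?invr_ge0 ?mulr_ge0 ?ler0n //; apply: ler_sum => e eE.
have uv := E_neq eE; set u := e.1 in uv *; set v := e.2 in uv *.
have -> : Phi (tperm u v * g)%g - Phi g = (phi v - phi u) * (psi (g u) - psi (g v)).
  rewrite Phi_swap -sumrB (bigD1 u) //= (bigD1 v) 1?eq_sym //= big1 => [|x /andP[xu xv]].
    by rewrite tpermL tpermR; ring.
  by rewrite tpermD 1?eq_sym // subrr.
rewrite exprMn mulrC -[X in _ * X <= _]sqrrN opprB ler_wpM2r ?sqr_ge0 //.
have := psi_le1 (g u); have := psi_le1 (g v); rewrite !ler_norml.
move=> /andP[a1 a2] /andP[b1 b2].
rewrite -ler_sqrt ?sqr_ge0 // sqrtr_sqr.
have -> : Num.sqrt 4 = 2 :> R by rewrite (_ : 4 = 2 ^+ 2) ?sqrtr_sqr ?ger0_norm //; ring.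
by rewrite ler_norml; apply/andP; split; lra.
Qed.
End VertexEigenfunction.
End InterchangeChain.

(** * The interchange process on the complete tree *)

(** Each of the [d^h] leaves of branch [i] contributes 1. *)
Lemma sum_radial_fun_sqr_ge (R : realFieldType) (d h : nat) (a : 'I_d -> R)
    (g : nat -> R) (i : 'I_d) : a i ^+ 2 = 1 -> g h.+1 = 1 ->
  d%:R ^+ h <= \sum_(v : tree_vertex d h.+1) radial_fun a g v ^+ 2.
Proof.
move=> ai gh.
pose f (t : h.-tuple 'I_d) : tree_vertex d h.+1 := insub_bseq h.+1 (i :: t).
have fE t : bseqval (f t) = i :: t.
  by rewrite /f /insub_bseq insubdK // unfold_in /= size_tuple.
have finj : injective f.
  by move=> s t /(congr1 (@bseqval _ _)); rewrite !fE => -[] /val_inj.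
rewrite (bigID (fun v => v \in f @: [set: h.-tuple 'I_d]%SET)) /=.
apply: ler_wpDr; first by apply: sumr_ge0 => v _; rewrite sqr_ge0.
rewrite big_imset /= => [|s t _ _ /finj //].
rewrite (eq_bigr (fun=> 1)) => [|t _]; last first.
  by rewrite /radial_fun fE /= size_tuple exprMn ai gh expr1n mulr1.
by rewrite sumr_const cardsT card_tuple card_ord natrX.
Qed.

Lemma tree_interchange (R : realType) (d h : nat) : (2 <= d)%N ->
  let m : R := #|tree_edges d h.+1|%:R in
  exists l : R,
  [/\ 0 < l, l * d%:R ^+ h <= 1,
      (d%:R - 1) ^+ 2 / d%:R ^+ h.+2 <= l &
      l <= (d%:R - 1) ^+ 2 / d%:R ^+ h.+2 +
           (d%:R ^+ 2 + 2 * d%:R) * h.+1%:R / (d%:R ^+ h.+1) ^+ 2] /\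
  spectral_gap (interchange_mx R (tree_edges d h.+1)) = l / (2 * m) /\
  forall t, 1 - 16 / (((1 - l / (2 * m)) ^+ t) ^+ 2 * d%:R ^+ h) <=
            interchange_tv R (tree_edges d h.+1) t.
Proof.
move=> d2 m.
have [l [g [[l0 ld llo lhi] [g0 gh gpos gk glast]]]] := exists_radial_profile R h d2.
exists l; split=> //.
set V := tree_vertex d h.+1; set E := tree_edges d h.+1.
pose r : V := tree_root d h.+1; pose p : V -> V := @tree_parent d h.+1.
have pneq v : v != r -> p v != v := @tree_parent_neq d h.+1 v.
have E0 : (0 < #|E|)%N.
  rewrite card_tree_edges // subn_gt0 tree_size_sum // big_ord_recl /= expn0.
  by rewrite -[X in (X < _)%N]addn0 ltn_add2l big_ord_recl /= ltn_addr // expn_gt0 ltnW.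
have m1 : 1 <= m by rewrite /m ler1n.
have d1 : 1 <= d%:R :> R by rewrite ler1n ltnW.
have l1 : l <= 1.
  by apply: le_trans ld; rewrite ler_peMr ?(ltW l0) // exprn_ege1.
pose gam := l / (2 * m).
have gam0 : 0 < gam by rewrite divr_gt0 // mulr_gt0 // (lt_le_trans ltr01).
have gam2 : 2 * gam <= 1.
  rewrite /gam (_ : 2 * _ = l / m); last by field; rewrite gt_eqF // (lt_le_trans ltr01).
  by rewrite ler_pdivrMr ?(lt_le_trans ltr01) // mul1r (le_trans l1).
pose i0 : 'I_d := Ordinal (ltnW d2); pose i1 : 'I_d := Ordinal d2.
pose a (i : 'I_d) : R := (i == i0)%:R - (i == i1)%:R.
have a0 : \sum_i a i = 0.
  have sum1 (j : 'I_d) : \sum_(i < d) (i == j)%:R = 1 :> R.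
    by rewrite (bigD1 j) //= eqxx big1 ?addr0 // => i /negPf->.
  by rewrite sumrB !sum1 subrr.
pose phi : V -> R := radial_fun a g.
have phi_lap x : laplacian r p phi x = l * phi x.
  have [->|xr] := eqVneq x r; first exact: laplacian_radial_fun_root.
  by apply: laplacian_radial_fun.
have phi_eig x : \sum_(e in E) (phi x - phi (tperm e.1 e.2 x)) = l * phi x.
  by rewrite sum_tree_edges -phi_lap.
have phi_energy : \sum_(e in E) (phi e.1 - phi e.2) ^+ 2 = l * \sum_x phi x ^+ 2.
  rewrite sum_tree_edges mulr_sumr.
  rewrite [RHS](eq_bigr (fun x => phi x * laplacian r p phi x)) => [|x _].
    by rewrite sum_mul_laplacian.
  by rewrite phi_lap; ring.
have phi_le1 x : `|phi x| <= 1.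
  rewrite /phi /radial_fun; have := size_bseq x.
  case: (bseqval x) => [|c s] sx; first by rewrite normr0.
  have /andP[gs0 gs1] := gpos (size (c :: s)) sx.
  rewrite normrM -[leRHS]mulr1 ler_pM //; last by rewrite ger0_norm // ltW.
  rewrite /a; case: (c == i0); case: (c == i1); rewrite ?subrr ?subr0 ?sub0r;
    by rewrite ?normrN ?normr0 ?normr1.
have E_neq e : e \in E -> e.1 != e.2.
  rewrite /E tree_edgesE => /imsetP[v]; rewrite !inE => vr -> /=.
  exact: pneq.
have Zge : d%:R ^+ h <= \sum_x phi x ^+ 2.
  by apply: (sum_radial_fun_sqr_ge (i := i0)) => //; rewrite /a eqxx subr0 expr1n.
set Z := \sum_x _ in Zge.
have Z0 : 0 < Z by rewrite (lt_le_trans _ Zge) // exprn_gt0 // (lt_le_trans ltr01).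
split.
  (* A child of the root, where [phi = g 1 > 0]; it makes the lifted eigenfunction nonzero at the
     identity. *)
  pose leaf : V := tree_child r i0.
  have leafE : phi leaf = g 1%N.
    rewrite /phi (radial_fun_rcons _ _ (tree_child_val i0 _)) //.
    by rewrite /a eqxx subr0 mul1r.
  apply: (@spectral_gap_interchange _ _ _ E0 l
    (fun q => \sum_x phi x * (q x == leaf)%:R) 1%g).
  - by rewrite gam0 /= -(ler_pM2l (_ : 0 < 2)) // mulr1 (le_trans gam2) // ler1n.
  - have psi_pos v : v != r -> 0 < radial_fun (fun=> 1) g v :> R.
      rewrite tree_root_size /radial_fun; have := size_bseq v.
      case: (bseqval v) => [|c s] // sv _.
      by rewrite mul1r; have /andP[] := gpos (size (c :: s)) sv.
    have VP : vertex_poincare r p [set: V]%SET l.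
      apply: (vertex_poincare_barta pneq (psi := radial_fun (fun=> 1) g)) => //.
        by move=> v vr; apply: laplacian_radial_fun.
      exact: ltW.
    have sT : subtree r p [set: V]%SET by split=> *; rewrite inE.
    have := perm_poincare_subtree (@tree_parent_lt d h.+1) (ltW l0) sT VP.
    move=> PP f f0; have := PP f.
    rewrite (eq_bigl xpredT) => [/(_ f0)|q]; last by rewrite perm_onT.
    rewrite (eq_bigl xpredT) => [|q]; last by rewrite perm_onT.
    move=> /le_trans; apply; rewrite sum_tree_edges le_eqVlt; apply/orP; left; apply/eqP.
    apply: eq_big => [v|v _]; first by rewrite !inE andbT.
    by apply: eq_bigl => q; rewrite perm_onT.
  - exact: (interchange_step_eig E0 (fun x => (x == leaf)%:R) phi_eig).
  - rewrite (bigD1 leaf) //= perm1 eqxx mulr1 big1 => [|x /negPf xl].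
      by rewrite addr0 leafE gt_eqF //; have /andP[] := gpos 1%N isT.
    by rewrite perm1 xl mulr0.
move=> t.
have Phi1 : \sum_x phi x * phi ((1 : {perm V})%g x) = Z.
  by apply: eq_bigr => x _; rewrite perm1.
have := @interchange_tv_ge _ _ _ E0 (fun q => \sum_x phi x * phi (q x)) gam (2 * Z)
  gam0 gam2 (mulr_ge0 (ler0n _ 2) (ltW Z0)) (interchange_step_eig E0 phi phi_eig)
  (interchange_eig_var phi_le1 E_neq phi_energy) t.
rewrite Phi1 => /(_ Z0); apply: le_trans.
rewrite lerD2l lerN2 -/gam.
have gt0 : 0 < ((1 - gam) ^+ t) ^+ 2.
  by rewrite !exprn_gt0 // subr_gt0; move: gam0 gam2; lra.
(* Wilson's bound with [B = 2 * Z] and initial value [Z]: one factor [Z] cancels, and the other is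
   at least [d^h]. *)
have -> : 8 * (2 * Z) / ((1 - gam) ^+ t * Z) ^+ 2 = 16 / (((1 - gam) ^+ t) ^+ 2 * Z).
  move: gt0; set b := (1 - gam) ^+ t => b0.
  have bn0 : b != 0 by apply: contraTneq b0 => ->; rewrite expr0n ltxx.
  by field; rewrite bn0 gt_eqF.
have dh0 : 0 < d%:R ^+ h :> R by rewrite exprn_gt0 // (lt_le_trans ltr01).
by rewrite ler_pM2l // lef_pV2 ?posrE ?(mulr_gt0 gt0) // ler_wpM2l // ltW.
Qed.

(** * Estimates in terms of the number of vertices *)

Section Asymptotics.
Variables (R : realType) (d h : nat).
Hypothesis d2 : (2 <= d)%N.
Let n : R := (tree_size d h.+1)%:R.

Let d1 : 2 <= d%:R :> R. Proof. by rewrite ler_nat. Qed.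
Let d0 : 0 < d%:R :> R. Proof. by rewrite ltr0n ltnW. Qed.

Lemma tree_size_mul : (d%:R - 1) * n = d%:R ^+ h.+2 - 1.
Proof.
rewrite /n tree_size_sum // natr_sum subrX1.
by under [in RHS]eq_bigr do rewrite -natrX.
Qed.

Lemma tree_size_ge : d%:R ^+ h.+1 <= n.
Proof.
rewrite /n tree_size_sum // natr_sum big_ord_recr /= natrX ler_wpDl //.
by apply: sumr_ge0 => i _; rewrite ler0n.
Qed.

Lemma tree_size_le : n <= d%:R ^+ h.+2.
Proof.
have n0 : 0 <= n by rewrite ler0n.
have := tree_size_mul; have : 0 <= (d%:R - 2) * n by rewrite mulr_ge0 // subr_ge0.
lra.
Qed.

Lemma tree_size_ge3 : 3 <= n.
Proof.
rewrite /n tree_size_sum // 2!big_ord_recl /= expn0 expn1 !natrD.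
have : 0 <= (\sum_(i < h) d ^ (bump 0 (bump 0 i)))%N%:R :> R by rewrite ler0n.
move: d1; lra.
Qed.

Lemma ln_tree_size_ge : h.+1%:R * ln d%:R <= ln n.
Proof.
rewrite mulr_natl -lnXn // ler_ln ?posrE ?exprn_gt0 //; first exact: tree_size_ge.
by rewrite (lt_le_trans _ tree_size_ge3).
Qed.

Lemma ln_tree_size_le : ln n <= h.+2%:R * ln d%:R.
Proof.
rewrite mulr_natl -lnXn // ler_ln ?posrE ?exprn_gt0 //; first exact: tree_size_le.
by rewrite (lt_le_trans _ tree_size_ge3).
Qed.

(** Serves to show that the height times [ln n] is [O(n)], so that relative errors of order [h / n]
    in the decay rate cost only [O(n^2)] steps. *)
Lemma sqr_height_le : h.+1%:R ^+ 2 <= 3 * n.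
Proof.
apply: (@le_trans _ _ (3 * 2 ^+ h.+1)); last first.
  rewrite ler_wpM2l // (le_trans _ tree_size_ge) //.
  by rewrite lerXn2r ?nnegrE ?(ltW d0).
(* Strengthened by [2 k + 3] so that the induction closes. *)
have : forall k : nat, k%:R ^+ 2 + 2 * k%:R + 3 <= 3 * 2 ^+ k :> R.
  elim=> [|k IH]; first by rewrite expr0n expr0 mulr0 !add0r mulr1.
  by rewrite -[k.+1%:R]natr1 [2 ^+ k.+1]exprS; have := sqr_ge0 (k%:R : R); lra.
by move=> /(_ h.+1); have : 0 <= h.+1%:R :> R; [rewrite ler0n | lra].
Qed.

Lemma tree_edges_size : #|tree_edges d h.+1|%:R = n - 1 :> R.
Proof.
rewrite card_tree_edges // natrB // -(ler_nat R).
by rewrite (le_trans _ tree_size_ge3) // ler_nat.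
Qed.

Variable l : R.
Hypothesis l0 : 0 < l.
Hypothesis l1 : l * d%:R ^+ h <= 1.
Hypothesis llo : (d%:R - 1) ^+ 2 / d%:R ^+ h.+2 <= l.
Hypothesis lhi : l <= (d%:R - 1) ^+ 2 / d%:R ^+ h.+2 +
           (d%:R ^+ 2 + 2 * d%:R) * h.+1%:R / (d%:R ^+ h.+1) ^+ 2.
(** The factor [d^2 + 2 d] of [lhi] times the [d^2] lost in passing to [n <= d * d^(h + 1)]. *)
Let K : R := d%:R ^+ 4 + 2 * d%:R ^+ 3.

Let K0 : 0 < K. Proof. by rewrite addr_gt0 ?mulr_gt0 ?exprn_gt0. Qed.

Lemma tree_eigenvalue_approx :
  l - (d%:R - 1) ^+ 2 / d%:R ^+ h.+2 <= K * h.+1%:R / n ^+ 2.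
Proof.
have n0 : 0 < n by rewrite (lt_le_trans _ tree_size_ge3).
apply: (@le_trans _ _ ((d%:R ^+ 2 + 2 * d%:R) * h.+1%:R / (d%:R ^+ h.+1) ^+ 2)).
  by rewrite lerBlDl.
rewrite ler_pdivrMr ?exprn_gt0 // mulrAC ler_pdivlMr ?exprn_gt0 //.
rewrite [leRHS](_ : _ = (d%:R ^+ 2 + 2 * d%:R) * h.+1%:R * (d%:R * d%:R ^+ h.+1) ^+ 2).
  rewrite ler_wpM2l ?mulr_ge0 ?addr_ge0 ?exprn_ge0 ?mulr_ge0 ?ler0n //.
  by rewrite lerXn2r ?nnegrE ?mulr_ge0 ?exprn_ge0 ?(ltW n0) ?(ltW d0) // -exprS tree_size_le.
by rewrite /K; ring.
Qed.

Lemma gap_approx :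
  `|l / (2 * (n - 1)) - (d%:R - 1) ^+ 2 / (2 * (n - 1) * d%:R ^+ h.+2)| <=
  K * `|ln n / ln d%:R / n ^+ 3|.
Proof.
have n3 := tree_size_ge3; have n0 : 0 < n by rewrite (lt_le_trans _ n3).
have n10 : 0 < n - 1 by move: n3; lra.
have lnd0 : 0 < ln d%:R :> R by rewrite ln_gt0 // (lt_le_trans _ d1) // ltr1n.
have lnn0 : 0 <= ln n by rewrite ln_ge0 // (le_trans _ n3) // ler1n.
have -> : l / (2 * (n - 1)) - (d%:R - 1) ^+ 2 / (2 * (n - 1) * d%:R ^+ h.+2) =
   (l - (d%:R - 1) ^+ 2 / d%:R ^+ h.+2) / (2 * (n - 1)).
  by field; rewrite !gt_eqF ?exprn_gt0.
rewrite [X in X <= _]ger0_norm; last by rewrite divr_ge0 ?mulr_ge0 ?(ltW n10) ?subr_ge0.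
rewrite ger0_norm; last by rewrite !divr_ge0 ?exprn_ge0 ?(ltW lnd0) ?(ltW n0).
apply: (@le_trans _ _ (K * h.+1%:R / n ^+ 2 / n)).
  apply: ler_pM; rewrite ?subr_ge0 ?tree_eigenvalue_approx ?invr_ge0 //.
    by rewrite mulr_ge0 ?(ltW n10).
  by rewrite lef_pV2 ?posrE ?mulr_gt0 //; move: n3; lra.
have -> : K * h.+1%:R / n ^+ 2 / n = K * (h.+1%:R / n ^+ 3).
  by field; rewrite gt_eqF.
rewrite ler_wpM2l ?(ltW K0) // ler_wpM2r ?invr_ge0 ?exprn_ge0 ?(ltW n0) //.
by rewrite ler_pdivlMr // ln_tree_size_ge.
Qed.

Let C2 : R := 3 * (d%:R - 1) + 2 * K.

(** With [gam] the gap and [rho] the left-hand side, [1 / (1 - gam) = 1 + rho / 2], so [rho] is the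
    exponential rate governing the squared mean. The main term comes from
    [(d - 1) * n <= d^(h + 2)]. *)
Lemma decay_rate_le : l / (n - 1 - l / 2) <= (d%:R - 1 + C2 * h.+1%:R / n) / n ^+ 2.
Proof.
have n3 := tree_size_ge3; have n0 : 0 < n by rewrite (lt_le_trans _ n3).
have l11 : l <= 1.
  by apply: le_trans l1; rewrite ler_peMr ?(ltW l0) // exprn_ege1 // (le_trans _ d1) // ler1n.
have den : 0 < n - 1 - l / 2 by move: n3 l11; lra.
have dd : 0 < d%:R - 1 :> R by move: d1; lra.
have H0 : 0 <= h.+1%:R :> R by rewrite ler0n.
have le1 : l <= (d%:R - 1) / n + K * h.+1%:R / n ^+ 2.
  apply: le_trans (_ : (d%:R - 1) ^+ 2 / d%:R ^+ h.+2 + K * h.+1%:R / n ^+ 2 <= _).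
    by rewrite -lerBlDl tree_eigenvalue_approx.
  rewrite lerD2r ler_pdivrMr ?exprn_gt0 // mulrAC ler_pdivlMr //.
  rewrite expr2 -mulrA ler_pM2l // tree_size_mul gerBl //.
have le2 : (n - 1 - l / 2)^-1 <= (1 + 3 / n) / n.
  rewrite -[X in X <= _]mul1r ler_pdivrMr //.
  apply: (@le_trans _ _ ((1 + 3 / n) / n * (n - 3 / 2))); last first.
    rewrite ler_wpM2l ?divr_ge0 ?addr_ge0 ?divr_ge0 ?(ltW n0) //.
    by move: l11; lra.
  have -> : (1 + 3 / n) / n * (n - 3 / 2) = 1 + (3 / 2 - 9 / 2 / n) / n.
    by field; rewrite gt_eqF.
  rewrite lerDl divr_ge0 ?(ltW n0) // subr_ge0 ler_pdivrMr //.
  by move: n3; lra.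
apply: le_trans (ler_pM (ltW l0) _ le1 le2) _; first by rewrite invr_ge0 ltW.
have -> : ((d%:R - 1) / n + K * h.+1%:R / n ^+ 2) * ((1 + 3 / n) / n) =
  (d%:R - 1 + (3 * (d%:R - 1) + K * h.+1%:R * (1 + 3 / n)) / n) / n ^+ 2.
  by field; rewrite gt_eqF.
rewrite ler_wpM2r ?invr_ge0 ?exprn_ge0 ?(ltW n0) // lerD2l.
rewrite ler_wpM2r ?invr_ge0 ?(ltW n0) //.
have : 3 / n <= 1 by rewrite ler_pdivrMr // mul1r.
have : 1 <= h.+1%:R :> R by rewrite ler1n.
set H : R := h.+1%:R in H0 *; set q := 3 / n => H1 q1.
have : 0 <= (d%:R - 1) * (H - 1) by rewrite mulr_ge0 ?(ltW dd) ?subr_ge0.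
have : 0 <= K * H * (1 - q) by rewrite mulr_ge0 ?mulr_ge0 ?(ltW K0) ?subr_ge0.
by rewrite /C2; set k := K; lra.
Qed.

(** The three terms absorb [ln 16], the gap of at most [2 * ln d] between [ln n] and [h * ln d], and
    the error in [t * rho]. *)
Let C : R := 16 + 2 * d%:R + 6 * d%:R * C2.

Lemma tree_mixing_time_bound (eps : R) (t : nat) : 0 < eps -> eps < 1 ->
  t%:R <= n ^+ 2 * ln n / (d%:R - 1) - n ^+ 2 * ln (1 / eps) / (d%:R - 1) - C * n ^+ 2 ->
  16 / (((1 - l / (2 * (n - 1))) ^+ t) ^+ 2 * d%:R ^+ h) <= eps.
Proof.
move=> eps0 eps1 tle.
have n3 := tree_size_ge3; have n0 : 0 < n by rewrite (lt_le_trans _ n3).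
have l11 : l <= 1.
  by apply: le_trans l1; rewrite ler_peMr ?(ltW l0) // exprn_ege1 // (le_trans _ d1) // ler1n.
have den : 0 < n - 1 - l / 2 by move: n3 l11; lra.
have n10 : 0 < n - 1 by move: n3; lra.
have dd : 1 <= d%:R - 1 :> R by move: d1; lra.
have dd0 : 0 < d%:R - 1 :> R by rewrite (lt_le_trans ltr01).
have lnd0 : 0 <= ln d%:R :> R by rewrite ln_ge0 // (le_trans _ d1) // ler1n.
have lnd : ln d%:R <= d%:R :> R by rewrite ltW // ln_sublinear.
have lnn0 : 0 <= ln n by rewrite ln_ge0 // (le_trans _ n3) // ler1n.
have C20 : 0 < C2 by rewrite /C2 addr_gt0 // mulr_gt0.
have H1 : 1 <= h.+1%:R :> R by rewrite ler1n.
have q0 : 0 < d%:R ^+ h :> R by rewrite exprn_gt0.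
set gam := l / (2 * (n - 1)).
pose rho := l / (n - 1 - l / 2).
have gamE : (1 - gam)^-1 ^+ 2 <= expR rho.
  have gamrho : (1 - gam)^-1 = 1 + rho / 2.
    by rewrite /gam /rho; field; rewrite !gt_eqF //; move: den; lra.
  have -> : expR rho = expR (rho / 2) ^+ 2.
    by rewrite -expRM_natl; congr expR; field.
  have rho0 : 0 < rho by rewrite divr_gt0.
  rewrite gamrho lerXn2r ?nnegrE ?expR_ge0 ?expR_ge1Dx //.
  by rewrite addr_ge0 // divr_ge0 // ltW.
have gam1 : 0 < 1 - gam.
  rewrite subr_gt0 /gam ltr_pdivrMr ?mulr_gt0 // mul1r; move: n3 l11; lra.
pose q := ln n + ln eps - C * (d%:R - 1).
have tq : t%:R <= n ^+ 2 / (d%:R - 1) * q.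
  apply: le_trans tle _; rewrite div1r lnV ?posrE // /q le_eqVlt; apply/orP; left.
  by apply/eqP; field; rewrite gt_eqF.
(* The hypothesis bounds [t >= 0] by a positive multiple of [q]. *)
have qge0 : 0 <= q.
  rewrite -(pmulr_lge0 _ (_ : 0 < n ^+ 2 / (d%:R - 1))) ?divr_gt0 ?exprn_gt0 //.
  by rewrite mulrC (le_trans _ tq).
have lneps : ln eps <= 0 by rewrite ln_le0 // ltW.
have C0 : 0 < C by rewrite /C !addr_gt0 // !mulr_gt0.
have qle : q <= ln n.
  have : 0 < C * (d%:R - 1) by rewrite mulr_gt0.
  by rewrite /q; move: lneps; lra.
have hln : h.+1%:R * ln n <= 6 * d%:R * n.
  apply: (@le_trans _ _ (h.+1%:R * (2 * h.+1%:R * d%:R))).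
    rewrite ler_wpM2l ?ler0n // (le_trans ln_tree_size_le) // ler_pM ?ler0n //.
    by rewrite -[h.+2%:R]natr1; lra.
  have := sqr_height_le; rewrite -(ler_pM2r (_ : 0 < 2 * d%:R)) ?mulr_gt0 //.
  by rewrite expr2; lra.
have trho : t%:R * rho <= q + 6 * d%:R * C2.
  apply: le_trans (ler_pM _ _ tq decay_rate_le) _; rewrite ?ler0n //.
    by rewrite divr_ge0 ?ltW.
  have -> : n ^+ 2 / (d%:R - 1) * q * ((d%:R - 1 + C2 * h.+1%:R / n) / n ^+ 2) =
     q + (q * h.+1%:R) * (C2 / (n * (d%:R - 1))).
    by field; rewrite !gt_eqF.
  rewrite lerD2l.
  apply: (@le_trans _ _ (6 * d%:R * n * (C2 / (n * (d%:R - 1))))).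
    rewrite ler_wpM2r ?divr_ge0 ?mulr_ge0 ?(ltW C20) ?(ltW n0) ?(ltW dd0) //.
    apply: le_trans hln; rewrite mulrC ler_wpM2l ?ler0n //.
  rewrite [leLHS](_ : _ = 6 * d%:R * C2 / (d%:R - 1)); last first.
    by field; rewrite !gt_eqF.
  by rewrite ler_pdivrMr // ler_peMr ?mulr_ge0 ?(ltW C20) ?(ltW d0).
have ln16 : ln 16 <= 16 :> R by rewrite ltW // ln_sublinear.
have final : t%:R * rho <= h%:R * ln d%:R + ln eps - ln 16.
  apply: le_trans trho _; rewrite /q.
  have Cle : C <= C * (d%:R - 1) by rewrite ler_peMr // ltW.
  have := ln_tree_size_le; rewrite -[h.+2%:R]natr1 -[h.+1%:R]natr1.
  have : 0 < d%:R * C2 by rewrite mulr_gt0.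
  set HL := h%:R * ln d%:R; move: ln16 lnd Cle; set CD := C * _.
  rewrite /C !mulrDl !mul1r -/HL.
  lra.
have le1 : ((1 - gam)^-1 ^+ 2) ^+ t <= d%:R ^+ h * eps / 16.
  apply: (@le_trans _ _ (expR (t%:R * rho))).
    by rewrite expRM_natl lerXn2r ?nnegrE ?expR_ge0 ?exprn_ge0 ?invr_ge0 ?(ltW gam1).
  rewrite -[leRHS]lnK ?posrE ?divr_gt0 ?mulr_gt0 // ler_expR.
  by rewrite ln_div ?posrE ?mulr_gt0 // lnM ?posrE // lnXn // -[ln _ *+ _]mulr_natl.
have -> : 16 / (((1 - gam) ^+ t) ^+ 2 * d%:R ^+ h) =
    16 / d%:R ^+ h * ((1 - gam)^-1 ^+ 2) ^+ t.
  rewrite -!exprM mulnC exprVn; field.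
  by rewrite !expf_neq0 ?gt_eqF.
apply: le_trans (ler_wpM2l _ le1) _; first by rewrite divr_ge0 // ltW.
by rewrite le_eqVlt; apply/orP; left; apply/eqP; field; rewrite gt_eqF.
Qed.
End Asymptotics.

Theorem theorem1p2 (R : realType) (d : nat) (hd : (2 <= d)%N) :
  (fun h : nat =>
     let n : R := (tree_size d h)%:R in
     spectral_gap (interchange_mx R (tree_edges d h))
       - (d%:R - 1) ^+ 2 / (2 * (n - 1) * d%:R ^+ h.+1))
  =O_\oo
  (fun h : nat =>
     let n : R := (tree_size d h)%:R in
     (ln n / ln d%:R) / n ^+ 3)
  /\
  exists2 C : R, 0 < C &
    forall eps : R, 0 < eps ->
      \forall h \near \oo, forall t : nat,
        let n : R := (tree_size d h)%:R in
        t%:R <= n ^+ 2 * ln n / (d%:R - 1)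
                - n ^+ 2 * ln (1 / eps) / (d%:R - 1) - C * n ^+ 2 ->
        1 - eps <= interchange_tv R (tree_edges d h) t.
Proof.
have d1 : 2 <= d%:R :> R by rewrite ler_nat.
have d0 : 0 < d%:R :> R by rewrite ltr0n ltnW.
have dd : 0 < d%:R - 1 :> R by move: d1; lra.
split.
  apply/eqO_exP; exists (d%:R ^+ 4 + 2 * d%:R ^+ 3).
    by rewrite addr_gt0 ?mulr_gt0 ?exprn_gt0.
  exists 1%N => // -[//|h] _ /=.
  have [l [[l0 l1 llo lhi] [-> _]]] := tree_interchange R h hd.
  by rewrite tree_edges_size //; apply: gap_approx.
exists (16 + 2 * d%:R + 6 * d%:R *
    (3 * (d%:R - 1) + 2 * (d%:R ^+ 4 + 2 * d%:R ^+ 3))); last first.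
  (* Height 1 suffices for every [eps]: if [eps >= 1] the claim is trivial, and otherwise the bound
     on [t] already forces [n] to be large when some [t] satisfies it. *)
  move=> eps eps0; exists 1%N => // -[//|h] _ /= t tle.
  have [eps1|eps1] := leP 1 eps.
    apply: (@le_trans _ _ 0); first by rewrite subr_le0.
    by rewrite mulr_ge0 ?invr_ge0 ?ler0n // sumr_ge0.
  have [l [[l0 l1 llo lhi] [_ /(_ t) tv]]] := tree_interchange R h hd.
  apply: le_trans tv; rewrite lerD2l lerN2 tree_edges_size //.
  exact: (tree_mixing_time_bound hd l0 l1 lhi eps0 eps1 tle).
have K0 : 0 < d%:R ^+ 4 + 2 * d%:R ^+ 3 :> R.
  by rewrite addr_gt0 ?mulr_gt0 ?exprn_gt0.
apply: addr_gt0; first by rewrite addr_gt0 ?mulr_gt0.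
by rewrite mulr_gt0 ?mulr_gt0 // addr_gt0 ?mulr_gt0.
Qed.
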